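(* Let $U_1,U_2,\dots$ be i.i.d. almost surely positive random variables distributed as $U$, with tail function $Q(x)=\mathbb{P}(U>x)$. Assume that $\mathbb{E}[U^2]<\infty$ and that there exist $\beta\in(0,1/2)$ and $x_0>0$ in the interior of the support of the distribution of $U$ such that $Q^{1/2-\beta}$ is convex on $[x_0,\infty)$. For each $N$, let $V_1\le\dots\le V_N$ be the order statistics of $(U_1,\dots,U_N)$, and, conditionally on $(V_1,\dots,V_N)$, let $(X_{i,j})_{1\le i<j\le N}$ be independent Bernoulli variables with $\mathbb{P}(X_{i,j}=1\mid V_1,\dots,V_N)=\frac{V_i}{V_i+V_j}$; set $X_{j,i}=1-X_{i,j}$ and $S_i=\sum_{j\neq i}X_{i,j}$. Then, with $\mathbb{P}$ the annealed probability (over both the $U_k$ and the $X_{i,j}$), \[\mathbb{P}(\text{player } N \text{ wins})\ \ge\ \mathbb{P}\Big(S_N>\max_{1\le i\le N-1}S_i\Big)\xrightarrow[N\to\infty]{}1,\] where ''player $N$ wins'' means that $S_N=\max_{1\le i\le N}S_i$.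
   Context: This is the Bradley–Terry model in random environment: $N$ players face each other once; $X_{i,j}=1$ means player $i$ beats player $j$; $S_i$ is the number of victories (score) of player $i$; a winner is any player with the highest score. Player $i$ has strength $V_i$, the $i$-th smallest of $U_1,\dots,U_N$. *)

(* Defs.v *)
From HB Require Import structures.
From mathcomp Require Import all_boot all_order all_algebra.
From mathcomp Require Import all_classical all_reals all_analysis.
Set Implicit Arguments. Unset Strict Implicit. Unset Printing Implicit Defensive.
Import Order.TTheory GRing.Theory Num.Theory.
Import numFieldNormedType.Exports.
Local Open Scope classical_set_scope.
Local Open Scope ring_scope.

Section BT.
Context {d : measure_display} {T : measurableType d} {R : realType}.
Variable P : probability T R.

Definition mutually_independent (U : nat -> T -> R) : Prop :=
  forall (s : seq nat) (B : nat -> set R),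
    uniq s -> (forall i, measurable (B i)) ->
    P (\big[setI/setT]_(i <- s) (U i @^-1` B i)) =
    (\prod_(i <- s) P (U i @^-1` B i))%E.

Definition identically_distributed (U : nat -> T -> R) : Prop :=
  forall (k : nat) (B : set R), measurable B ->
    P (U k @^-1` B) = P (U 0%N @^-1` B).

Definition tail (X : T -> R) (x : R) : R := fine (P [set w | x < X w]).

Definition law_support (X : T -> R) : set R :=
  [set x | forall e : R, 0 < e -> (0%E < P [set w | `|X w - x| < e])%O].
End BT.

Definition convex_on_from {R : realType} (f : R -> R) (a : R) : Prop :=
  forall x y t : R, a <= x -> a <= y -> 0 <= t <= 1 ->
    f (t * x + (1 - t) * y) <= t * f x + (1 - t) * f y.

(** Tournament between N players 'I_N.  An outcome is x : {ffun 'I_N*'I_N -> bool};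
    only the entries (i,j) with i < j are used: x (i,j) = X_{i,j}. *)
Definition beats {N : nat} (x : {ffun 'I_N * 'I_N -> bool}) (i j : 'I_N) : bool :=
  if (i < j)%N then x (i, j) else if (j < i)%N then ~~ x (j, i) else false.

Definition score {N : nat} (x : {ffun 'I_N * 'I_N -> bool}) (i : 'I_N) : nat :=
  (\sum_(j < N | j != i) beats x i j)%N.

(** Probability of outcome x given strengths V: the X_{i,j} (i<j) are independent
    Bernoulli(V_i/(V_i+V_j)); entries off the upper triangle are a.s. false. *)
Definition outcome_weight {R : realType} {N : nat} (V : 'I_N -> R)
    (x : {ffun 'I_N * 'I_N -> bool}) : R :=
  \prod_(p : 'I_N * 'I_N)
    (if (p.1 < p.2)%N then
       (if x p then V p.1 / (V p.1 + V p.2) else V p.2 / (V p.1 + V p.2))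
     else (if x p then 0 else 1)).

Definition order_stats {R : realType} (N : nat) (u : nat -> R) : 'I_N -> R :=
  fun i => nth 0 (sort <=%R [seq u k | k <- iota 0 N]) i.

Definition cond_prob {R : realType} {N : nat} (V : 'I_N -> R)
    (E : pred {ffun 'I_N * 'I_N -> bool}) : R :=
  \sum_(x | E x) outcome_weight V x.

(** Events for N = n+1 players; player N is ord_max. *)
Definition last_wins {n : nat} (x : {ffun 'I_n.+1 * 'I_n.+1 -> bool}) : bool :=
  [forall i, (score x i <= score x ord_max)%N].
Definition last_wins_strictly {n : nat} (x : {ffun 'I_n.+1 * 'I_n.+1 -> bool}) : bool :=
  [forall i, (i != ord_max) ==> (score x i < score x ord_max)%N].

Definition annealed {d : measure_display} {T : measurableType d} {R : realType}
    (P : probability T R) (U : nat -> T -> R) (n : nat)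
    (E : pred {ffun 'I_n.+1 * 'I_n.+1 -> bool}) : R :=
  Rintegral P setT (fun w => cond_prob (@order_stats R n.+1 (fun k => U k w)) E).

(* Main.v *)
(* Write Q for the tail of U and f = Q^g with g = 1/2 - beta, which may be
   enlarged so that 1/4 <= g < 1/2.  Given strengths V, comparing numbers of
   losses by an exponential moment bound gives, for i below the top player k,
     P(S_i >= S_k) <= exp (- m^2 / (8 s)),
   m = sum_j (V_j/(V_i+V_j) - V_j/(V_k+V_j)),
   s = sum_j (V_j/(V_i+V_j) + V_j/(V_k+V_j)).
   If V_i stays bounded the exponent is of order N.  Otherwise it is of order
   N (V_k - V_i)^2 / (V_k^2 V_i), up to N^eps.  Since Q(x) = O(x^-2), convexity
   of f gives V_k - V_i >= c V_i^(3/2) (f(V_i) - f(V_k)), and f(U) has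
   distribution function t^(1/g) near 0, so with high probability the least
   value of f(U_l) is separated from the others by N^(- g - O(eps)).  The
   exponent is thus at least a positive power of N, which absorbs the union
   bound over i.  Only pairwise independence enters: Chebyshev's inequality
   for counts of players, a union bound over pairs of players with close
   f-values, and Markov's inequality for the sum of the U_l^2. *)
Require Import Defs.
From HB Require Import structures.
From mathcomp Require Import all_boot all_order all_algebra.
From mathcomp Require Import all_classical all_reals all_analysis.
From mathcomp Require Import measurable_realfun.
From mathcomp Require Import ring lra zify.
Import Order.TTheory GRing.Theory Num.Theory.
Import numFieldNormedType.Exports.
Local Open Scope classical_set_scope.
Local Open Scope ring_scope.

Set Implicit Arguments.
Unset Strict Implicit.
Unset Printing Implicit Defensive.

(** * Scores in a Bradley-Terry tournament *)

(** Outcomes are indexed by games, that is pairs [a < b]. A game contributes to the sum for [i] only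
    if [i] is one of its two players, and then through the other one. *)
Lemma big_ltn_pair (S : nmodType) (n : nat) (i : 'I_n) (F : 'I_n -> S) :
  \sum_(j | j != i) F j =
  \sum_(p : 'I_n * 'I_n | (p.1 < p.2)%N)
     ((if p.1 == i then F p.2 else 0) + (if p.2 == i then F p.1 else 0)).
Proof.
rewrite big_split /=.
rewrite -(pair_big_dep xpredT (fun a b : 'I_n => (a < b)%N)
  (fun a b => if a == i then F b else 0)) /=.
rewrite -(pair_big_dep xpredT (fun a b : 'I_n => (a < b)%N)
  (fun a b => if b == i then F a else 0)) /=.
rewrite [in X in _ = _ + X](exchange_big_dep xpredT) //=.
rewrite [in X in _ = X + _](bigD1 i)//= [in X in _ = _ + X](bigD1 i)//=.
rewrite [X in _ = _ + X + _]big1 ?addr0; last first.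
  by move=> j /negbTE jNi; rewrite big1// => k _; rewrite jNi.
rewrite [X in _ = _ + (_ + X)]big1 ?addr0; last first.
  by move=> j /negbTE jNi; rewrite big1// => k _; rewrite jNi.
rewrite (bigID (fun j : 'I_n => (i < j)%N)) /= eqxx; congr (_ + _).
  by apply: eq_bigl => j; rewrite -val_eqE /=; lia.
by apply: eq_bigl => j; rewrite -val_eqE /=; lia.
Qed.

Definition loser {N : nat} (p : 'I_N * 'I_N) (b : bool) : 'I_N :=
  if b then p.2 else p.1.

(** A score is [N - 1] minus the number of losses, so the constant cancels and the difference
    becomes a sum of terms each depending on a single game. *)
Lemma score_sub {R : realType} {N : nat} (x : {ffun 'I_N * 'I_N -> bool})
    (i k : 'I_N) :
  (score x i)%:R - (score x k)%:R =
  \sum_(p : 'I_N * 'I_N | (p.1 < p.2)%N)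
     ((loser p (x p) == k)%:R - (loser p (x p) == i)%:R) :> R.
Proof.
have H j : (score x j)%:R = (N.-1)%:R -
    \sum_(p : 'I_N * 'I_N | (p.1 < p.2)%N) (loser p (x p) == j)%:R :> R.
  have -> : (N.-1)%:R = \sum_(l : 'I_N | l != j) (1 : R).
    by rewrite sumr_const cardC1 card_ord.
  rewrite /score natr_sum !big_ltn_pair -sumrB; apply: eq_bigr => -[a b] /= ab.
  rewrite /beats /loser /= -!val_eqE /=.
  case: eqP => [aj|aj]; case: eqP => [bj|bj].
  - by move: ab; rewrite aj bj ltnn.
  - have {aj bj}-> : j = a by apply/val_inj.
    rewrite ab; case: (x (a, b)) => /=; rewrite ?eqxx ?addr0 ?subrr //.
    by case: eqP => [e|_]; rewrite ?subr0//; move: ab; rewrite e ltnn.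
  - have {aj bj}-> : j = b by apply/val_inj.
    rewrite ltnNge (ltnW ab) /= ab; case: (x (a, b)) => /=;
      rewrite ?eqxx ?add0r ?subrr //.
    by case: eqP => [e|_]; rewrite ?subr0//; move: ab; rewrite e ltnn.
  - rewrite addr0; case: (x (a, b)); case: eqP => //; rewrite ?subr0 //.
by rewrite !H sumrB; ring.
Qed.

(** From [1 - t <= expR (- t)] one gets [(1 - t) * expR t <= 1], while the quadratic times [1 - t]
    equals [1 + t ^+ 2 * (1 - 2 * t)], which is at least 1. *)
Lemma expR_le1Dx2 {R : realType} (t : R) :
  t <= 2^-1 -> expR t <= 1 + t + 2 * t ^+ 2.
Proof.
move=> t2; have : 1 - t <= expR (- t) by rewrite expR_ge1Dx.
rewrite expRN => h.
have e0 : 0 < expR t by exact: expR_gt0.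
have h' : (1 - t) * expR t <= 1.
  by rewrite -ler_pdivlMr// div1r.
have q : 1 <= (1 - t) * (1 + t + 2 * t ^+ 2).
  have -> : (1 - t) * (1 + t + 2 * t ^+ 2) = 1 + t ^+ 2 * (1 - 2 * t) by ring.
  by rewrite lerDl mulr_ge0 ?sqr_ge0//; lra.
have t1 : 0 < 1 - t by lra.
by rewrite -(ler_pM2l t1); exact: le_trans q.
Qed.

Definition win_prob {R : realType} {N : nat} (V : 'I_N -> R) (p : 'I_N * 'I_N)
    (b : bool) : R :=
  (if b then V p.1 else V p.2) / (V p.1 + V p.2).

(** Off the upper triangle this is the point mass at [false], so an outcome weight is a product over
    all pairs and sums over outcomes factorise by distributivity. *)
Definition game_weight {R : realType} {N : nat} (V : 'I_N -> R)
    (p : 'I_N * 'I_N) (b : bool) : R :=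
  if (p.1 < p.2)%N then win_prob V p b else (~~ b)%:R.

Lemma outcome_weightE {R : realType} {N : nat} (V : 'I_N -> R) x :
  outcome_weight V x = \prod_p game_weight V p (x p).
Proof.
apply: eq_bigr => p _; rewrite /game_weight /win_prob.
by case: ifP => // _; case: (x p).
Qed.

Section positive_strengths.
Context {R : realType} {N : nat} (V : 'I_N -> R).
Hypothesis V0 : forall i, 0 < V i.

Lemma win_prob_ge0 p b : 0 <= win_prob V p b.
Proof. by rewrite divr_ge0 ?addr_ge0 ?ltW//; case: b. Qed.

Lemma win_prob_sum p : win_prob V p true + win_prob V p false = 1.
Proof. by rewrite -mulrDl divff// gt_eqF// addr_gt0. Qed.

Lemma outcome_weight_ge0 x : 0 <= outcome_weight V x.
Proof.
rewrite outcome_weightE; apply: prodr_ge0 => p _; rewrite /game_weight.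
by case: ifP => _; rewrite ?win_prob_ge0.
Qed.

Lemma cond_probT : cond_prob V predT = 1.
Proof.
rewrite /cond_prob; under eq_bigr do rewrite outcome_weightE.
rewrite -(bigA_distr_bigA (fun p b => game_weight V p b)) big1// => p _.
rewrite big_bool /game_weight; case: ifP => _; [exact: win_prob_sum|exact: add0r].
Qed.

Lemma cond_prob_ge0 E : 0 <= cond_prob V E.
Proof. by apply: sumr_ge0 => x _; exact: outcome_weight_ge0. Qed.

Lemma cond_prob_le E F : {subset E <= F} -> cond_prob V E <= cond_prob V F.
Proof.
move=> EF; rewrite /cond_prob (big_mkcond E) (big_mkcond F) ler_sum// => x _.
have := EF x; rewrite /in_mem /=; case: (E x) => [->//|_].
by case: (F x) => //; exact: outcome_weight_ge0.
Qed.

Lemma cond_prob_le1 E : cond_prob V E <= 1.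
Proof. by rewrite -cond_probT; apply: cond_prob_le. Qed.

(** Both sides are the expected number of losses of player [i], counted by games on the left and by
    opponents on the right. *)
Lemma sum_loses i :
  \sum_(p : 'I_N * 'I_N | (p.1 < p.2)%N)
     (\sum_b win_prob V p b * (loser p b == i)%:R) =
  \sum_(j | j != i) V j / (V i + V j).
Proof.
rewrite big_ltn_pair; apply: eq_bigr => -[a b] /= ab.
rewrite big_bool /win_prob /loser /= addrC; congr (_ + _).
  by case: eqP => [->|]; rewrite ?mulr1 ?mulr0.
by case: eqP => [->|]; rewrite ?mulr1 ?mulr0// addrC.
Qed.

(* Losses rather than wins: a strong player loses rarely, so the second-order
   term is small compared with what Hoeffding's inequality would give. *)
Lemma game_mgf (i k : 'I_N) (l : R) p : i != k -> 0 <= l <= 2^-1 ->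
  \sum_b win_prob V p b *
     expR (l * ((loser p b == k)%:R - (loser p b == i)%:R)) <=
  expR (\sum_b win_prob V p b * ((l + 2 * l ^+ 2) * (loser p b == k)%:R
     + (2 * l ^+ 2 - l) * (loser p b == i)%:R)).
Proof.
move=> ik /andP[l0 l2]; apply: le_trans (expR_ge1Dx _).
rewrite [X in _ <= X + _](_ : 1 = \sum_b win_prob V p b); last first.
  by rewrite big_bool; exact/esym/win_prob_sum.
rewrite -big_split /=; apply: ler_sum => b _.
rewrite -[X in _ <= X + _]mulr1 -mulrDr ler_wpM2l ?win_prob_ge0//.
case: eqP => [->|_]; case: eqP => [e|_].
- by rewrite e eqxx in ik.
- rewrite [true%:R]/(1 : R) [false%:R]/(0 : R) subr0 mulr0 !mulr1 addr0; have := expR_le1Dx2 l2; lra.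
- rewrite [true%:R]/(1 : R) [false%:R]/(0 : R) sub0r mulrN mulr0 !mulr1 add0r.
  have := @expR_le1Dx2 _ (- l); rewrite sqrrN => h.
  by have := h ltac:(lra); lra.
- by rewrite subrr !mulr0 expR0; lra.
Qed.

(** Exponential Markov inequality for the difference of losses: independence of the games factorises
    the moment, and [game_mgf] bounds each factor. *)
Lemma chernoff_score (i k : 'I_N) (l : R) : i != k -> 0 <= l <= 2^-1 ->
  cond_prob V [pred x | (score x k <= score x i)%N] <=
  expR ((l + 2 * l ^+ 2) * \sum_j V j / (V k + V j)
        + (2 * l ^+ 2 - l) * \sum_j V j / (V i + V j)).
Proof.
move=> ik l02; have /andP[l0 l2] := l02.
(* The indicator of the event is at most the exponential of [l] times (score of [i] minus score of
   [k]), written game by game. *)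
apply: (@le_trans _ _ (\sum_(x : {ffun 'I_N * 'I_N -> bool}) \prod_p (game_weight V p (x p) *
   (if (p.1 < p.2)%N then
      expR (l * ((loser p (x p) == k)%:R - (loser p (x p) == i)%:R)) else 1)))).
  rewrite /cond_prob big_mkcond ler_sum// => x _.
  rewrite big_split /= -outcome_weightE -big_mkcond /= -expR_sum -mulr_sumr.
  rewrite -score_sub.
  case: ifPn => [xki|_]; last by rewrite mulr_ge0 ?outcome_weight_ge0 ?expR_ge0.
  rewrite ler_peMr ?outcome_weight_ge0// -[leLHS]expR0 ler_expR mulr_ge0//.
  by rewrite subr_ge0 ler_nat.
rewrite -(bigA_distr_bigA (fun p b => game_weight V p b *
   (if (p.1 < p.2)%N then
      expR (l * ((loser p b == k)%:R - (loser p b == i)%:R)) else 1))) /=.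
pose c p := \sum_b win_prob V p b * ((l + 2 * l ^+ 2) * (loser p b == k)%:R
     + (2 * l ^+ 2 - l) * (loser p b == i)%:R).
apply: (@le_trans _ _ (\prod_(p : 'I_N * 'I_N | (p.1 < p.2)%N) expR (c p))).
  rewrite [leRHS]big_mkcond ler_prod// => p _; apply/andP; split.
    apply: sumr_ge0 => b _; rewrite /game_weight.
    by case: ifP => _; rewrite mulr_ge0 ?win_prob_ge0 ?expR_ge0.
  rewrite /game_weight; case: ifP => _; first exact: game_mgf.
  by rewrite big_bool /= mul0r add0r mul1r.
rewrite -expR_sum ler_expR.
have -> : \sum_(p : 'I_N * 'I_N | (p.1 < p.2)%N) c p =
    (l + 2 * l ^+ 2) * \sum_(j | j != k) V j / (V k + V j) +
    (2 * l ^+ 2 - l) * \sum_(j | j != i) V j / (V i + V j).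
  rewrite -!sum_loses !mulr_sumr -big_split /=; apply: eq_bigr => p _.
  by rewrite /c !big_bool /=; ring.
(* The sums in the claim include the player itself. The two extra terms are [1 / 2] each and add
   [2 * l ^+ 2] to the exponent, which only weakens the bound. *)
rewrite [in leRHS](bigD1 k)//= [X in _ <= _ + _ * X](bigD1 i)//=.
have h j : V j / (V j + V j) = 2^-1 by have := V0 j; move=> ?; field; lra.
rewrite !h; have : 0 <= l ^+ 2 by rewrite sqr_ge0.
by lra.
Qed.

(** The exponent is at most [- l * m + 2 * l ^+ 2 * s], minimal at [l = m / (4 * s)]. This choice
    satisfies [l <= 1 / 2] because [m <= s]. *)
Lemma chernoff_score_opt (i k : 'I_N) (m s : R) : i != k -> 0 <= m ->
  m <= \sum_j V j / (V i + V j) - \sum_j V j / (V k + V j) ->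
  \sum_j V j / (V i + V j) + \sum_j V j / (V k + V j) <= s ->
  cond_prob V [pred x | (score x k <= score x i)%N] <=
  expR (- (m ^+ 2 / (8 * s))).
Proof.
move=> ik m0.
have b0 : 0 <= \sum_j V j / (V k + V j).
  by apply: sumr_ge0 => j _; rewrite divr_ge0 ?addr_ge0 ?ltW.
have a0 : 0 < \sum_j V j / (V i + V j).
  rewrite (bigD1 i)//= ltr_wpDr ?divr_gt0 ?addr_gt0//.
  by apply: sumr_ge0 => j _; rewrite divr_ge0 ?addr_ge0 ?ltW.
have := @chernoff_score i k (m / (4 * s)) ik.
set a := \sum_j V j / (V i + V j) in a0 *.
set b := \sum_j V j / (V k + V j) in b0 * => H mab abs.
have s0 : 0 < s by lra.
apply: le_trans (H _) _.
  apply/andP; split; first by rewrite divr_ge0// mulr_ge0// ltW.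
  by rewrite ler_pdivrMr ?mulr_gt0//; lra.
rewrite ler_expR.
set l := m / (4 * s).
have l0 : 0 <= l by rewrite divr_ge0// mulr_ge0// ltW.
have -> : m ^+ 2 / (8 * s) = l * m - 2 * l ^+ 2 * s.
  by rewrite /l; field; lra.
have h1 : l * m <= l * (a - b) by rewrite ler_wpM2l.
have h2 : l ^+ 2 * (a + b) <= l ^+ 2 * s by rewrite ler_wpM2l// sqr_ge0.
clearbody l a b; rewrite -subr_ge0.
have -> : - (l * m - 2 * l ^+ 2 * s) - ((l + 2 * l ^+ 2) * b + (2 * l ^+ 2 - l) * a)
  = l * (a - b) - l * m + 2 * (l ^+ 2 * s - l ^+ 2 * (a + b)) by ring.
by lra.
Qed.

End positive_strengths.

(** * Comparison of the scores of two players with ordered strengths *)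

Section score_comparison.
Context {R : realType} {N : nat} (V : 'I_N -> R) (i k : 'I_N).
Hypothesis V0 : forall j, 0 < V j.
Hypothesis ik : i != k.
Hypothesis Vik : V i <= V k.
Context (a b kappa : R).
Hypothesis a0 : 0 < a.
Hypothesis b0 : 0 < b.
Hypothesis kappa0 : 0 <= kappa.
Hypothesis kappaP : kappa <= \sum_j ((a <= V j <= b)%R)%:R.

(** Every summand of the difference of expected losses is nonnegative. Only the opponents with
    strength in [[a, b]] are kept; there are at least [kappa] of them, and each contributes at least
    the stated amount. *)
Lemma mean_gap_lb :
  kappa * (a * (V k - V i) / ((V i + b) * (V k + b))) <=
  \sum_j V j / (V i + V j) - \sum_j V j / (V k + V j).
Proof.
set c := _ / _; have c0 : 0 <= c.
  by rewrite divr_ge0 ?mulr_ge0 ?subr_ge0 ?addr_ge0// ltW.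
apply: (@le_trans _ _ (\sum_j ((a <= V j <= b)%R)%:R * c)).
  by rewrite -mulr_suml ler_wpM2r.
rewrite -sumrB; apply: ler_sum => j _.
have y0 := V0 i; have z0 := V0 k; have v0 := V0 j.
have -> : V j / (V i + V j) - V j / (V k + V j) =
    (V k - V i) * (V j / ((V i + V j) * (V k + V j))).
  by field; lra.
case: (boolP (a <= V j <= b)) => [/andP[av vb]|_]; last first.
  by rewrite mul0r mulr_ge0 ?subr_ge0// divr_ge0 ?mulr_ge0 ?addr_ge0 ?ltW.
rewrite mul1r /c [a * _]mulrC -mulrA ler_wpM2l ?subr_ge0//.
apply: ler_pM => //; first exact: ltW.
  by rewrite invr_ge0 mulr_ge0 ?addr_ge0// ltW.
rewrite lef_pV2 ?posrE ?mulr_gt0 ?addr_gt0//.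
by apply: ler_pM; rewrite ?lerD2l// addr_ge0// ltW.
Qed.

Lemma mean_sum_le_card :
  \sum_j V j / (V i + V j) + \sum_j V j / (V k + V j) <= 2 * N%:R.
Proof.
have h l : \sum_j V j / (V l + V j) <= N%:R.
  rewrite -[leRHS]mulr1 -[N in leRHS]card_ord mulr_natl -sumr_const.
  apply: ler_sum => j _; have y0 := V0 l; have v0 := V0 j.
  by rewrite ler_pdivrMr ?addr_gt0// mul1r lerDr ltW.
by have := h i; have := h k; lra.
Qed.

(** Both denominators are at least [V i]. For a strong player [i] this improves on the bound by the
    number of players. *)
Lemma mean_sum_le_sum :
  \sum_j V j / (V i + V j) + \sum_j V j / (V k + V j) <=
  2 * (\sum_j V j) / V i.
Proof.
have h l : V i <= V l -> \sum_j V j / (V l + V j) <= (\sum_j V j) / V i.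
  move=> il; rewrite mulr_suml; apply: ler_sum => j _.
  have y0 := V0 l; have v0 := V0 j; have i0 := V0 i.
  by rewrite ler_wpM2l ?(ltW v0)// lef_pV2 ?posrE ?addr_gt0//; lra.
by have := h _ Vik; have := h _ (lexx _); lra.
Qed.

(** The ratio [(z - y) / ((y + b) * (z + b))] decreases in [y] and increases in [z], so the worst
    case is [y = A], [z = A + d]. *)
Lemma cond_prob_upset_weak (A d : R) : 0 < A -> 0 < d ->
  V i <= A -> A + d <= V k ->
  cond_prob V [pred x | (score x k <= score x i)%N] <=
  expR (- ((kappa * (a * d / ((A + b) * (A + d + b)))) ^+ 2 / (16 * N%:R))).
Proof.
move=> A0 d0 iA Ak; have y0 := V0 i; have z0 := V0 k.
have -> : 16 * N%:R = 8 * (2 * N%:R) :> R by ring.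
apply: chernoff_score_opt; rewrite ?mean_sum_le_card//.
  by rewrite mulr_ge0// divr_ge0 ?mulr_ge0 ?addr_ge0 ?ltW.
apply: le_trans mean_gap_lb; rewrite ler_wpM2l//.
have E u v w : a * u / (v * w) = a * (v^-1 * (u / w)).
  by rewrite invfM; ring.
rewrite !E ler_wpM2l ?(ltW a0)//.
apply: ler_pM.
- by rewrite invr_ge0 addr_ge0// ltW.
- by rewrite mulr_ge0 ?(ltW d0)// invr_ge0 !addr_ge0// ltW.
- by rewrite lef_pV2 ?posrE ?addr_gt0// lerD2r.
rewrite ler_pdivrMr ?addr_gt0// mulrAC ler_pdivlMr ?addr_gt0//.
have : 0 <= (V k - (A + d)) * (A + b) by rewrite mulr_ge0 ?subr_ge0 ?addr_ge0// ltW.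
have : 0 <= (A - V i) * (A + d + b).
  by rewrite mulr_ge0 ?subr_ge0 ?addr_ge0// ltW.
by move: A0 d0 => _ _; nra.
Qed.

(** The exponent is governed by [(z - y) ^+ 2 / (y * z ^+ 2)] with [y = V i], [z = V k]. The
    parameter [w] is a lower bound for it, and the two conditions on [w] correspond to [z] at least
    or below [2 * y]. *)
Lemma cond_prob_upset_strong (A C delta S w : R) : 0 < A -> 0 < C -> A <= V i ->
  \sum_j V j <= S ->
  V i ^+ 3 * delta ^+ 2 <= C * (V k - V i) ^+ 2 ->
  0 <= w -> 4 * w * V i <= 1 -> 4 * C * w <= delta ^+ 2 ->
  cond_prob V [pred x | (score x k <= score x i)%N] <=
  expR (- (kappa ^+ 2 * (a * A ^+ 2 / (A + b) ^+ 2) ^+ 2 * w / (16 * S))).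
Proof.
move=> A0 C0 Ai sS gap w0 w1 w2; have y0 := V0 i; have z0 := V0 k.
have S0 : 0 < S.
  apply: lt_le_trans sS; rewrite (bigD1 i)//= ltr_wpDr//.
  by apply: sumr_ge0 => j _; exact: ltW.
set c := a * A ^+ 2 / (A + b) ^+ 2.
have c0 : 0 <= c by rewrite divr_ge0 ?mulr_ge0 ?exprn_ge0 ?addr_ge0 ?ltW.
have cE : c = a * A ^+ 2 / (A + b) ^+ 2 by [].
clearbody c.
set y := V i in Ai gap w1 y0 *; set z := V k in gap z0 *.
have yz : y <= z by [].
apply: le_trans (chernoff_score_opt V0 (m := kappa * (c * (z - y) / (y * z)))
   (s := 2 * S / y) ik _ _ _) _.
- by rewrite mulr_ge0// divr_ge0 ?mulr_ge0 ?subr_ge0// ltW.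
- apply: le_trans mean_gap_lb; rewrite ler_wpM2l// -/y -/z.
  have -> : c * (z - y) / (y * z) =
      a * (z - y) * ((A / ((A + b) * y)) * (A / ((A + b) * z))).
    by rewrite cE; field; rewrite !gt_eqF// addr_gt0.
  apply: ler_wpM2l; first by rewrite mulr_ge0 ?subr_ge0// ltW.
  (* For [u >= A] the shift by [b] costs only a constant factor: [u + b <= (A + b) * u / A]. *)
  rewrite [leRHS]invfM; have h u : A <= u -> A / ((A + b) * u) <= (u + b)^-1.
    move=> Au; have u0 := lt_le_trans A0 Au.
    rewrite ler_pdivrMr ?mulr_gt0 ?addr_gt0// mulrC ler_pdivlMr ?addr_gt0//.
    have : 0 <= b * (u - A) by rewrite mulr_ge0 ?subr_ge0// ltW.
    by lra.
  apply: ler_pM; [| |exact: h|apply: h; lra].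
    by rewrite divr_ge0 ?mulr_ge0 ?addr_ge0// ltW.
  by rewrite divr_ge0 ?mulr_ge0 ?addr_ge0// ltW.
- apply: le_trans mean_sum_le_sum _; rewrite -/y ler_wpM2r ?invr_ge0 ?(ltW y0)//.
  by rewrite ler_pM2l.
rewrite ler_expR lerN2.
have -> : (kappa * (c * (z - y) / (y * z))) ^+ 2 / (8 * (2 * S / y)) =
    kappa ^+ 2 * c ^+ 2 * ((z - y) ^+ 2 / (y * z ^+ 2)) / (16 * S).
  by field; rewrite !gt_eqF.
rewrite ler_wpM2r ?invr_ge0 ?mulr_ge0 ?(ltW S0)//.
rewrite ler_wpM2l ?mulr_ge0 ?sqr_ge0//.
rewrite ler_pdivlMr ?mulr_gt0 ?exprn_gt0//.
(* When [z >= 2 y] the relative gap [(z - y) / z] is at least [1 / 2], and [gap]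
   is not needed. *)
have [z2|z2] := lerP (2 * y) z.
  have : z ^+ 2 <= 4 * (z - y) ^+ 2.
    have -> : 4 * (z - y) ^+ 2 = (2 * (z - y)) ^+ 2 by ring.
    by rewrite ler_pXn2r ?nnegrE//; lra.
  have : 4 * w * y * z ^+ 2 <= 1 * z ^+ 2 by rewrite ler_wpM2r ?sqr_ge0.
  by lra.
(* Here [z < 2 * y], and [gap] bounds [(z - y) ^+ 2 / (y * z ^+ 2)] below by
   [delta ^+ 2 / (4 * C)]. *)
have h1 : z ^+ 2 <= (2 * y) ^+ 2 by rewrite ler_pXn2r ?nnegrE//; lra.
have h2 : w * y * z ^+ 2 <= w * y * (2 * y) ^+ 2.
  by rewrite ler_wpM2l// mulr_ge0// ltW.
have h3 : y ^+ 3 * (4 * C * w) <= y ^+ 3 * delta ^+ 2.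
  by rewrite ler_wpM2l// exprn_ge0// ltW.
rewrite -(ler_pM2l C0); apply: le_trans gap; apply: le_trans h3.
have -> : y ^+ 3 * (4 * C * w) = C * (w * y * (2 * y) ^+ 2) by ring.
by rewrite ler_pM2l// mulrA.
Qed.

End score_comparison.

(** * Convex tails *)

Section convex_tails.
Context {R : realType} (f : R -> R) (x0 : R).
Hypothesis fconv : convex_on_from f x0.

(** Monotonicity of the slopes of chords, with denominators cleared so that [y = z] is allowed. *)
Lemma convex_on_from_slope (w y z : R) : x0 <= w -> w < y -> y <= z ->
  (f y - f z) * (y - w) <= (z - y) * (f w - f y).
Proof.
move=> x0w wy yz; have wz : 0 < z - w by lra.
have : 0 <= (z - y) / (z - w) <= 1.
  by apply/andP; split; [rewrite divr_ge0//; lra|rewrite ler_pdivrMr// mul1r; lra].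
move=> /(@fconv w z _ x0w); set t := (z - y) / (z - w).
have tE : t * (z - w) = z - y by rewrite /t divfK// gt_eqF.
have -> : t * w + (1 - t) * z = y by lra.
move=> /(_ ltac:(lra)) h.
have : f y * (z - w) <= (t * f w + (1 - t) * f z) * (z - w).
  by rewrite ler_wpM2r// ltW.
have -> : (t * f w + (1 - t) * f z) * (z - w) =
   t * (z - w) * f w + (z - w - t * (z - w)) * f z by ring.
rewrite tE; lra.
Qed.

(* The slope of [f] beyond [y] is at most its mean slope between [(x0 + y) / 2]
   and [y], which the decay of [f] bounds by a multiple of [y] to the [-3/2]. *)
Lemma convex_gap (K A : R) : 0 < x0 -> x0 < A -> 0 < K ->
  (forall x, x0 <= x -> 0 <= f x) ->
  (forall x, x0 <= x -> f x ^+ 2 * x <= K) ->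
  exists2 C, 0 < C & forall y z, A <= y -> y <= z -> f z <= f y ->
    y ^+ 3 * (f y - f z) ^+ 2 <= C * (z - y) ^+ 2.
Proof.
move=> x00 x0A K0 f0 fK; have A0 : 0 < A by lra.
(* Chosen so that [y * k <= (y - x0) / 2] for all [y >= A], with equality at [A]. *)
pose k := (A - x0) / (2 * A).
have k0 : 0 < k by rewrite divr_gt0 ?mulr_gt0// subr_gt0.
have kE : k = (A - x0) / (2 * A) by [].
clearbody k.
exists (2 * K / k ^+ 2) => [|y z Ay yz fzy].
  by rewrite divr_gt0 ?mulr_gt0 ?exprn_gt0.
pose w := (x0 + y) / 2.
have yw : y * k <= y - w.
  rewrite kE mulrA ler_pdivrMr ?mulr_gt0// /w.
  have : 0 <= x0 * (y - A) by rewrite mulr_ge0 ?subr_ge0// ltW.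
  by move=> ?; lra.
have y0 : 0 < y by lra.
have x0w : x0 <= w by rewrite /w; lra.
have w0 : 0 < w by lra.
have yk0 : 0 < y * k by rewrite mulr_gt0.
have s1 : (f y - f z) * (y * k) <= (z - y) * f w.
  apply: (@le_trans _ _ ((f y - f z) * (y - w))).
    by rewrite ler_wpM2l// subr_ge0.
  apply: le_trans (convex_on_from_slope x0w _ yz) _; first lra.
  by rewrite ler_wpM2l ?subr_ge0// gerBl f0//; lra.
have s2 : ((f y - f z) * (y * k)) ^+ 2 <= ((z - y) * f w) ^+ 2.
  rewrite ler_pXn2r ?nnegrE//; first by rewrite mulr_ge0 ?subr_ge0// ltW.
  by rewrite mulr_ge0 ?subr_ge0 ?f0.
have s3 : ((f y - f z) * (y * k)) ^+ 2 * w <= (z - y) ^+ 2 * K.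
  apply: (@le_trans _ _ (((z - y) * f w) ^+ 2 * w)).
    by rewrite ler_wpM2r// ltW.
  by rewrite exprMn -mulrA ler_wpM2l ?sqr_ge0// fK.
rewrite [leRHS]mulrAC ler_pdivlMr ?exprn_gt0//.
have -> : y ^+ 3 * (f y - f z) ^+ 2 * k ^+ 2 =
  2 * (((f y - f z) * (y * k)) ^+ 2 * (y / 2)) by field.
have : ((f y - f z) * (y * k)) ^+ 2 * (y / 2) <= ((f y - f z) * (y * k)) ^+ 2 * w.
  by rewrite ler_wpM2l ?sqr_ge0// /w; lra.
by move=> ?; lra.
Qed.

(** Beyond [A] the slopes are bounded by the slope [L] between [x0] and [A], so [f] is Lipschitz
    there. Composing with [Num.max A] gives a function continuous on the whole line. *)
Lemma convex_on_from_continuous (A : R) : x0 < A ->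
  (forall x y, x <= y -> f y <= f x) -> continuous (fun x => f (Num.max A x)).
Proof.
move=> x0A fni x; pose L := (f x0 - f A) / (A - x0).
have Ax0 : 0 < A - x0 by rewrite subr_gt0.
have fx0A : f A <= f x0 by rewrite fni// ltW.
have L0 : 0 <= L by rewrite divr_ge0 ?subr_ge0// ltW.
have lip u v : A <= u -> u <= v -> `|f u - f v| <= L * (v - u).
  move=> Au uv; rewrite ger0_norm ?subr_ge0 ?fni//.
  have [Av|vA] := eqVneq A v.
    have -> : u = v by lra.
    by rewrite !subrr mulr0.
  have s1 : (f u - f v) * (A - x0) <= (f u - f v) * (u - x0).
    by rewrite ler_wpM2l ?subr_ge0 ?fni//; lra.
  rewrite -(ler_pM2r Ax0) mulrAC /L divfK ?gt_eqF//.
  (* At [u = A] one chord inequality suffices; for [u > A] two are chained through the chord from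
     [A] to [u]. *)
  have [uA|Au'] := eqVneq u A.
    have := @convex_on_from_slope x0 u v (lexx _) ltac:(lra) uv.
    by rewrite uA; lra.
  have {Au'}Au' : A < u by rewrite lt_neqAle eq_sym Au' Au.
  have h1 := @convex_on_from_slope A u v (ltW x0A) Au' uv.
  have h2 := @convex_on_from_slope x0 A u (lexx _) x0A Au.
  have uA0 : 0 < u - A by lra.
  rewrite -(ler_pM2r uA0).
  have g1 : (f u - f v) * (u - A) * (A - x0) <= (v - u) * (f A - f u) * (A - x0).
    by rewrite ler_wpM2r// ltW.
  have g2 : (v - u) * ((f A - f u) * (A - x0)) <= (v - u) * ((u - A) * (f x0 - f A)).
    by rewrite ler_wpM2l// subr_ge0.
  by lra.
have lip2 u v : `|f (Num.max A u) - f (Num.max A v)| <= L * `|u - v|.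
  wlog uv : u v / u <= v.
    move=> h; have [|vu] := leP u v; first exact: h.
    by rewrite distrC [`|u - v|]distrC h// ltW.
  apply: (le_trans (lip _ _ _ _)).
  - by rewrite le_max lexx.
  - by rewrite ge_max !le_max lexx uv orbT.
  - rewrite ler_wpM2l// distrC ger0_norm ?subr_ge0//.
    by rewrite /Num.max; case: ltP => ?; case: ltP => ?; lra.
apply/cvgrPdist_le => /= e e0; near=> t.
apply: le_trans (lip2 _ _) _.
apply: (@le_trans _ _ ((L + 1) * `|x - t|)); first by rewrite ler_wpM2r// lerDl.
rewrite -ler_pdivlMl ?ltr_wpDl// mulrC.
near: t; apply: (cvgr_dist_le id x cvg_id).
by rewrite divr_gt0// ltr_wpDl.
Unshelve. all: by end_near. Qed.

Lemma convex_on_from_ivt (A t : R) : x0 < A ->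
  (forall x y, x <= y -> f y <= f x) ->
  (exists x, f x <= t) -> t <= f A -> exists2 x, A <= x & f x = t.
Proof.
move=> x0A fni [x fxt] tA.
have fm : f (Num.max A x) <= t by apply: le_trans fxt; rewrite fni// le_max lexx orbT.
have Am : A <= Num.max A x by rewrite le_max lexx.
have := @IVT R (fun u => f (Num.max A u)) A (Num.max A x) t Am.
have /continuous_subspaceT c := convex_on_from_continuous x0A fni.
move=> /(_ (c _)); rewrite maxxx maxA maxxx.
have fAm : f (Num.max A x) <= f A by rewrite fni.
rewrite (min_idPr fAm) (max_idPl fAm) fm tA => /(_ isT)[u].
by rewrite in_itv/= => _ ut; exists (Num.max A u); rewrite ?le_max ?lexx.
Qed.

End convex_tails.

(** A nondecreasing convex power of a nonnegative convex function is convex. It serves to enlarge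
    the exponent of the tail. *)
Lemma convex_on_from_powR {R : realType} (f : R -> R) (x0 p : R) : 1 <= p ->
  (forall x, 0 <= f x) ->
  convex_on_from f x0 -> convex_on_from (fun x => powR (f x) p) x0.
Proof.
move=> p1 f0 cf x y t x0x x0y /[dup] t01 /andP[t0 t1].
have p0 : 0 <= p by lra.
apply: le_trans (ge0_ler_powR p0 _ _ (cf _ _ _ x0x x0y t01)) _.
- by rewrite nnegrE f0.
- by rewrite nnegrE addr_ge0// mulr_ge0 ?subr_ge0.
have := @convex_powR R p p1 (@Itv01 R t t0 t1) (f x) (f y).
rewrite !inE /= !in_itv /= !andbT !f0 => /(_ isT isT).
by rewrite !convRE.
Qed.

Lemma powR_sub_le {R : realType} (s t r : R) : 0 <= s -> s <= t -> 0 < t ->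
  0 < r -> r <= 4 -> t `^ r - s `^ r <= 4 * t `^ (r - 1) * (t - s).
Proof.
(* Since [r <= 4], [(s / t) `^ r >= (s / t) ^+ 4 >= 1 - 4 (1 - s / t)]. *)
move=> s0 st t0 r0 r4.
have : t `^ r = t * t `^ (r - 1) by rewrite mulr_powRB1// ltW.
have : 0 <= t `^ (r - 1) by rewrite powR_ge0.
move: (t `^ (r - 1)) => T T0 tr.
move: s0; rewrite le_eqVlt => /orP[/eqP <-|s0].
  rewrite powR0 ?gt_eqF// tr !subr0 -mulrA [T * t]mulrC.
  by have : 0 <= t * T by [rewrite mulr_ge0// ltW]; move: (t * T) => u ?; lra.
have st1 : 0 < s / t <= 1 by rewrite divr_gt0//= ler_pdivrMr// mul1r.
have -> : s `^ r = t `^ r * (s / t) `^ r.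
  rewrite -powRM ?(ltW t0)//; last by rewrite divr_ge0// ltW.
  by rewrite mulrCA divff ?mulr1// gt_eqF.
have su : s = t * (s / t) by rewrite mulrCA divff ?mulr1// gt_eqF.
rewrite [X in _ * (t - X)]su tr; move: st1; move: (s / t) => u /andP[u0 u1].
have : u ^+ 4 <= u `^ r.
  by rewrite -powR_mulrn ?(ltW u0)//; apply: ger_powR; rewrite ?u0.
move: (u `^ r) => ur; have : 1 - 4 * (1 - u) <= u ^+ 4.
  have -> : u ^+ 4 = 1 - 4 * (1 - u) + (1 - u) ^+ 2 * (2 + (1 + u) ^+ 2) by ring.
  by rewrite lerDl mulr_ge0 ?addr_ge0 ?sqr_ge0.
move=> h1 h2; rewrite -[X in X - _]mulr1 -mulrBr.
have -> : 4 * T * (t - t * u) = t * T * (4 * (1 - u)) by ring.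
rewrite ler_wpM2l ?mulr_ge0 ?(ltW t0)//.
by have := le_trans h1 h2; move: (ur) => ?; lra.
Qed.

(** * Probability of finite combinations of events *)

Section finite_sums_of_indicators.
Context {d : measure_display} {T : measurableType d} {R : realType}.
Variable P : probability T R.

Local Notation pr A := (fine (P A)).

Lemma pr_fin (A : set T) : measurable A -> P A = (pr A)%:E.
Proof. by move=> mA; rewrite fineK// fin_num_measure. Qed.

Lemma pr_le (A B : set T) : measurable A -> measurable B -> A `<=` B ->
  pr A <= pr B.
Proof.
by move=> mA mB AB; rewrite fine_le ?fin_num_measure// le_measure ?inE.
Qed.

Lemma measurable_le_set (f g : T -> R) : measurable_fun setT f ->
  measurable_fun setT g -> measurable [set w | f w <= g w].
Proof.
by move=> mf mg; rewrite -[X in measurable X]setTI; exact: measurable_fun_le.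
Qed.

Lemma measurable_lt_set (f g : T -> R) : measurable_fun setT f ->
  measurable_fun setT g -> measurable [set w | f w < g w].
Proof.
move=> mf mg; have -> : [set w | f w < g w] = ~` [set w | g w <= f w].
  by apply/seteqP; split => w /=; rewrite ltNge => /negP.
exact/measurableC/measurable_le_set.
Qed.

(* Lists of pairs (coefficient, event) encode nonnegative simple functions. *)
Definition weighted (s : seq (R * set T)) :=
  forall q, q \in s -> 0 <= q.1 /\ measurable q.2.

Lemma weighted_ge0 s w : weighted s -> 0 <= \sum_(q <- s) q.1 * \1_(q.2) w.
Proof.
move=> hs; rewrite big_seq; apply: sumr_ge0 => q /hs[q0 _].
by rewrite mulr_ge0// indicE.
Qed.

Lemma weighted_measurable s : weighted s ->
  measurable_fun setT (fun w => \sum_(q <- s) q.1 * \1_(q.2) w : R).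
Proof.
elim: s => [_|q s IH hs].
  by under eq_fun do rewrite big_nil; exact: measurable_cst.
under eq_fun do rewrite big_cons.
apply: measurable_funD; last by apply: IH => r rs; apply: hs; rewrite inE rs orbT.
apply: measurable_funM => //; apply: measurable_indic.
by have [] := hs q (mem_head _ _).
Qed.

Lemma integral_weighted s : weighted s ->
  (\int[P]_w (\sum_(q <- s) q.1 * \1_(q.2) w)%:E =
   (\sum_(q <- s) q.1 * pr q.2)%:E)%E.
Proof.
elim: s => [_|q s IH hs].
  by rewrite big_nil; under eq_integral do rewrite big_nil; rewrite integral0.
have hs' : weighted s by move=> r rs; apply: hs; rewrite inE rs orbT.
have [q0 mq] := hs q (mem_head _ _).
under eq_integral do rewrite big_cons EFinD EFinM.
rewrite ge0_integralD//=.
- rewrite IH// ge0_integralZl_EFin//.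
  + by rewrite integral_indic// setIT big_cons EFinD EFinM -pr_fin.
  + by apply/measurable_EFinP; exact: measurable_indic.
- by move=> w _; rewrite -EFinM lee_fin mulr_ge0// indicE.
- apply/measurable_EFinP; apply: measurable_funM => //; exact: measurable_indic.
- by move=> w _; rewrite lee_fin weighted_ge0.
- by apply/measurable_EFinP; exact: weighted_measurable.
Qed.

Lemma weighted_le_integral s (g : T -> R) (c : R) : weighted s ->
  measurable_fun setT g -> (\int[P]_w (g w)%:E <= c%:E)%E ->
  (forall w, \sum_(q <- s) q.1 * \1_(q.2) w <= g w) ->
  \sum_(q <- s) q.1 * pr q.2 <= c.
Proof.
move=> hs mg ic sg; rewrite -lee_fin; apply: le_trans ic.
rewrite -integral_weighted//; apply: ge0_le_integral => //.
- by move=> w _; rewrite lee_fin weighted_ge0.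
- by apply/measurable_EFinP; exact: weighted_measurable.
- by apply/measurable_EFinP.
- by move=> w _; rewrite lee_fin.
Qed.

(** Union bounds and Chebyshev's inequality are obtained from this by checking a pointwise
    inequality between simple functions. *)
Lemma weighted_le s t : weighted s -> weighted t ->
  (forall w, \sum_(q <- s) q.1 * \1_(q.2) w <= \sum_(q <- t) q.1 * \1_(q.2) w) ->
  \sum_(q <- s) q.1 * pr q.2 <= \sum_(q <- t) q.1 * pr q.2.
Proof.
move=> hs ht; apply: weighted_le_integral => //.
  exact: weighted_measurable.
by rewrite integral_weighted.
Qed.

Lemma pr_bigcup_le (I : finType) (A : I -> set T) :
  (forall i, measurable (A i)) -> pr (\bigcup_i A i) <= \sum_i pr (A i).
Proof.
move=> mA; have mU : measurable (\bigcup_i A i).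
  by apply: fin_bigcup_measurable => //; exact: finite_finset.
have := @weighted_le [:: (1, \bigcup_i A i)] [seq (1, A i) | i <- index_enum I].
rewrite big_seq1 big_map mul1r /=; under [X in _ <= X]eq_bigr do rewrite mul1r.
apply.
- by move=> q; rewrite inE => /eqP -> /=; split.
- by move=> q /mapP[i _ ->] /=; split.
move=> w; rewrite big_seq1 big_map mul1r /=.
under [X in _ <= X]eq_bigr do rewrite mul1r.
rewrite indicE; case: (boolP (w \in _)) => [|_]; last first.
  by apply: sumr_ge0 => i _; rewrite indicE.
rewrite inE => -[i _ Ai]; rewrite (bigD1 i)//= indicE mem_set// lerDl.
by apply: sumr_ge0 => j _; rewrite indicE.
Qed.

Lemma pr_setU_le (A B : set T) : measurable A -> measurable B ->
  pr (A `|` B) <= pr A + pr B.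
Proof.
move=> mA mB.
have := @weighted_le [:: (1, A `|` B)] [:: (1, A); (1, B)].
rewrite !big_cons !big_nil /= !mul1r !addr0; apply.
- by move=> q; rewrite inE => /eqP -> /=; split => //; exact: measurableU.
- by move=> q; rewrite !inE => /orP[]/eqP -> /=; split.
move=> w; rewrite !big_cons !big_nil /= !mul1r !addr0 !indicE in_setU.
by case: (w \in A); case: (w \in B); rewrite /= ?addr0 ?add0r// lerDl.
Qed.

Lemma chebyshev_count (A : nat -> set T) (p : R) (N : nat) :
  (forall k, measurable (A k)) -> (forall k, pr (A k) = p) ->
  (forall k l, k != l -> pr (A k `&` A l) = p ^+ 2) -> 0 < p -> (0 < N)%N ->
  measurable [set w | \sum_(k < N) \1_(A k) w <= N%:R * p / 2] /\
  pr [set w | \sum_(k < N) \1_(A k) w <= N%:R * p / 2] <= 4 / (N%:R * p).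
Proof.
move=> mA pA pAA p0 N0; set D := [set w | _].
have mD : measurable D.
  apply: measurable_le_set => //; apply: measurable_sum => k.
  exact: measurable_indic.
split=> //; set m := N%:R * p.
have m0 : 0 < m by rewrite mulr_gt0// ltr0n.
have mE : m = N%:R * p by [].
clearbody m.
(* With [z] the count and [m] its mean, [s] and [t] encode the two sides of [m ^+ 2 / 4 * \1_D + 2 *
   m * z <= m ^+ 2 + z ^+ 2], true because [z <= m / 2] on [D]. The square of [z] is expanded over
   pairs of events. *)
pose s := (m ^+ 2 / 4, D) :: [seq (2 * m, A (val k)) | k <- index_enum 'I_N].
pose t := (m ^+ 2, setT) ::
  [seq (1 : R, A (val k) `&` A (val l)) | k <- index_enum 'I_N, l <- index_enum 'I_N].
have : \sum_(q <- s) q.1 * pr q.2 <= \sum_(q <- t) q.1 * pr q.2.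
  apply: weighted_le.
  - move=> q; rewrite inE => /orP[/eqP -> /=|/mapP[k _ -> /=]].
      by rewrite divr_ge0 ?sqr_ge0.
    by rewrite mulr_ge0// ltW.
  - move=> q; rewrite inE => /orP[/eqP -> /=|/allpairsP[kl [_ _ ->]] /=].
      by rewrite sqr_ge0.
    by split=> //; exact: measurableI.
  move=> w; rewrite !big_cons !big_map !big_allpairs_dep /= -mulr_sumr.
  have -> : \sum_(k < N) \sum_(l < N) 1 * \1_(A k `&` A l) w =
      (\sum_(k < N) \1_(A k) w) ^+ 2 :> R.
    rewrite expr2 mulr_suml; apply: eq_bigr => k _; rewrite mulr_sumr.
    by apply: eq_bigr => l _; rewrite mul1r indicI.
  rewrite [\1_setT w]indicE mem_setT mulr1 [\1_D w]indicE.
  set z := \sum_(k < N) _; have zz : 0 <= (m - z) ^+ 2 by rewrite sqr_ge0.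
  case: (boolP (w \in D)) => [|_]; last by rewrite mulr0; lra.
  rewrite inE /D /= -/z -mE => zm.
  have : (m / 2) ^+ 2 <= (m - z) ^+ 2.
    by rewrite ler_pXn2r ?nnegrE ?divr_ge0 ?(ltW m0)//; lra.
  by lra.
rewrite /s /t !big_cons !big_map !big_allpairs_dep /= probability_setT /=.
under eq_bigr do rewrite pA.
rewrite sumr_const card_ord -[_ *+ N]mulr_natl => H.
(* The expectation of [z ^+ 2]: pairwise independence off the diagonal, and at most [p + p ^+ 2] on
   it. *)
have h : \sum_(k < N) \sum_(l < N) 1 * pr (A k `&` A l) <= m + m ^+ 2.
  apply: (@le_trans _ _ (\sum_(k < N) \sum_(l < N) ((k == l)%:R * p + p ^+ 2))).
    apply: ler_sum => k _; apply: ler_sum => l _; rewrite mul1r.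
    case: (eqVneq k l) => [->|kl]; last by rewrite pAA// mul0r add0r.
    by rewrite setIid pA mul1r lerDl sqr_ge0.
  under eq_bigr => k _.
    rewrite big_split /= -mulr_suml (bigD1 k)//= eqxx big1 ?addr0; last first.
      by move=> l /negbTE; rewrite eq_sym => ->.
    rewrite mul1r sumr_const card_ord -mulr_natl; over.
  by rewrite sumr_const card_ord -mulr_natl mE; lra.
have {H} : m ^+ 2 / 4 * pr D + N%:R * (2 * m * p) <= m ^+ 2 * 1 + (m + m ^+ 2).
  by apply: le_trans H _; rewrite lerD2l.
have -> : N%:R * (2 * m * p) = 2 * m ^+ 2 by rewrite mE; ring.
move=> h2; rewrite ler_pdivlMr//.
have : m * (pr D * m) <= m * 4 by lra.
by rewrite ler_pM2l.
Qed.

End finite_sums_of_indicators.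

(** Writing the inverse as [x] times the power [-1] of the nonnegative [x ^+ 2] reduces it to a
    measurable real power; at 0 both sides vanish. *)
Lemma invr_measurable {R : realType} : measurable_fun setT (@GRing.inv R).
Proof.
have -> : @GRing.inv R = fun x => x * (x ^+ 2) `^ (-1).
  apply/funext => x; rewrite powR_inv1 ?sqr_ge0//.
  have [->|x0] := eqVneq x 0; first by rewrite invr0 mul0r.
  by rewrite expr2 invfM mulrA divff// mul1r.
apply: measurable_funM => //.
rewrite -[X in measurable_fun _ X]/((@powR R ^~ (-1)) \o (fun x => x ^+ 2)).
apply: measurableT_comp; first exact: measurable_powR.
exact: measurable_funX.
Qed.

(** * Order statistics and their measurability *)

Section order_statistics.
Context {R : realType} (u : nat -> R) (n : nat).
Local Notation N := n.+1.
Local Notation V := (@order_stats R N u).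

Lemma order_stats_perm :
  exists2 f : 'I_N -> 'I_N, injective f & forall i, V i = u (f i).
Proof.
have : perm_eq (sort <=%R [seq u k | k <- iota 0 N]) [seq u k | k <- iota 0 N].
  by rewrite perm_sort.
move=> /(perm_iotaP 0)[Is]; rewrite size_map size_iota => pI sE.
have sI : size Is = N by rewrite (perm_size pI) size_iota.
have uI : uniq Is by rewrite (perm_uniq pI) iota_uniq.
have ltI (i : 'I_N) : (nth 0%N Is i < N)%N.
  have : nth 0%N Is i \in Is by rewrite mem_nth// sI.
  by rewrite (perm_mem pI) mem_iota.
exists (fun i => Ordinal (ltI i)).
  move=> i j [] /eqP; rewrite nth_uniq ?sI// => /eqP; exact: val_inj.
move=> i; rewrite /order_stats sE (nth_map 0%N) ?sI//.
by rewrite (nth_map 0%N) ?size_iota// nth_iota.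
Qed.

Lemma order_stats_le (i j : 'I_N) : (i <= j)%N -> V i <= V j.
Proof.
move=> ij; rewrite /order_stats.
apply: (sorted_leq_nth le_trans lexx) => //; rewrite ?inE ?size_sort ?size_map ?size_iota//.
by apply: sort_sorted; exact: le_total.
Qed.

(** Positions start at 0, so [V i <= t] means that at least [i + 1] of the values are at most [t].
    Counts are sums of indicators, whence measurability. *)
Lemma order_stats_le_count (i : 'I_N) (t : R) :
  (V i <= t) = (i < \sum_(k < N) (u k <= t)%R)%N.
Proof.
have so : sorted <=%O (sort <=%R [seq u k | k <- iota 0 N]).
  by apply: sort_sorted; exact: le_total.
have -> : (\sum_(k < N) (u k <= t)%R)%N =
    count (<= t)%O (sort <=%R [seq u k | k <- iota 0 N]).
  rewrite count_sort -sum1_count big_map.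
  rewrite -[iota 0 N]/(index_iota 0 N) big_mkord [RHS]big_mkcond; apply: eq_bigr => k _.
  by rewrite /=; case: (u k <= t).
apply/idP/idP => [|h]; last exact: nth_count_le.
set s := sort _ _ in so *.
have sz : size s = N by rewrite size_sort size_map size_iota.
move=> it; rewrite -[X in count _ X](cat_take_drop i.+1) count_cat.
have /eqP -> : count (<= t)%O (take i.+1 s) == size (take i.+1 s).
  rewrite -all_count; apply/(all_nthP 0) => j.
  rewrite size_takel ?sz// => ji; rewrite nth_take//=.
  apply: le_trans it; apply: (sorted_leq_nth le_trans lexx) => //.
  - by rewrite inE sz (leq_trans ji).
  - by rewrite inE sz.
by rewrite size_takel ?sz// ltn_addr.
Qed.

End order_statistics.

Lemma order_stats_measurable {d : measure_display} {T : measurableType d}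
    {R : realType} (U : nat -> T -> R) (n : nat) (i : 'I_n.+1) :
  (forall k, measurable_fun setT (U k)) ->
  measurable_fun setT (fun w => @order_stats R n.+1 (fun k => U k w) i).
Proof.
move=> mU _; apply: (measurability _ (RGenOInfty.measurableE R)) => //.
move=> /= _ [_ [t ->] <-]; rewrite setTI preimage_itvoy.
rewrite [X in measurable X](_ : _ = [set w |
  \sum_(k < n.+1) \1_[set w | U k w <= t] w <= i%:R :> R]).
  apply: measurable_le_set => //; apply: measurable_sum => k.
  exact/measurable_indic/measurable_le_set.
have E w k : \1_[set w | U k w <= t] w = (U k w <= t)%R%:R :> R.
  by rewrite indicE; congr (_%:R); congr nat_of_bool; apply/idP/idP; rewrite inE.
have H w : (t < order_stats (fun k => U k w) i) =
    (\sum_(k < n.+1) \1_[set w | U k w <= t] w <= i%:R :> R).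
  rewrite ltNge order_stats_le_count -leqNgt -(ler_nat R) natr_sum.
  by congr (_ <= _); apply: eq_bigr => k _; rewrite E.
by apply/seteqP; split => w /=; rewrite H.
Qed.

(** * Annealed probabilities and moments *)

Lemma measurable_if_cst {d} {T : measurableType d} {R : realType} (b : bool)
    (f g : T -> R) : measurable_fun setT f -> measurable_fun setT g ->
  measurable_fun setT (fun w => if b then f w else g w).
Proof. by case: b. Qed.

Section annealed_bounds.
Context {d : measure_display} {T : measurableType d} {R : realType}.
Variables (P : probability T R) (U : nat -> {RV P >-> R}) (n : nat).
Hypothesis U_id : identically_distributed P (fun k => U k).
Hypothesis U_gt0 : P [set w | U 0%N w <= 0] = 0%E.

Local Notation pr A := (fine (P A)).
Local Notation outcome := {ffun 'I_n.+1 * 'I_n.+1 -> bool}.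
Local Notation V w := (@order_stats R n.+1 (fun k => U k w)).

Lemma measurable_RV k : measurable_fun setT (U k).
Proof. exact: measurable_funPT. Qed.

Lemma pr_preimage k (B : set R) : measurable B ->
  pr (U k @^-1` B) = pr (U 0%N @^-1` B).
Proof. by move=> mB; rewrite (U_id k mB). Qed.

Lemma cond_prob_measurable (E : pred outcome) :
  measurable_fun setT (fun w => cond_prob (V w) E).
Proof.
have mV i : measurable_fun setT (fun w => V w i).
  by apply: (@order_stats_measurable _ _ _ (fun k => U k)) => k; exact: measurable_RV.
rewrite /cond_prob; under eq_fun do rewrite big_mkcond.
apply: measurable_sum => x; apply: measurable_if_cst => //.
under eq_fun do rewrite outcome_weightE; apply: measurable_prod => p _.
apply: measurable_if_cst => //.
have mD : measurable_fun setT (fun w => (V w p.1 + V w p.2)^-1).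
  apply: (measurableT_comp (@invr_measurable R)).
  exact: measurable_funD.
by apply: measurable_funM => //; exact: measurable_if_cst.
Qed.

Definition all_positive : set T := \bigcap_(k in [set k | (k < n.+1)%N]) [set w | 0 < U k w].

Lemma all_positive_measurable : measurable all_positive.
Proof.
apply: bigcap_measurable => [|k _]; first by exists 0%N.
by apply: measurable_lt_set; [exact: measurable_cst|exact: measurable_RV].
Qed.

Lemma all_positive_ae : P (~` all_positive) = 0%E.
Proof.
have E : ~` all_positive = \bigcup_(k in [set k | (k < n.+1)%N]) [set w | U k w <= 0].
  rewrite /all_positive setC_bigcap; apply: eq_bigcupr => k _.
  by apply/seteqP; split => w /=; rewrite leNgt => /negP.
rewrite E bigcup_mkord; apply/eqP; rewrite eq_le measure_ge0 andbT.
have m0 k : measurable [set w | U k w <= 0].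
  by apply: measurable_le_set; [exact: measurable_RV|exact: measurable_cst].
apply: le_trans (@Boole_inequality _ _ _ P (fun k => [set w | U k w <= 0]) n.+1
  (fun k _ => m0 k)) _.
rewrite big1// => k _.
have := @U_id (val k) `]-oo, 0]%classic (measurable_itv _).
rewrite preimage_itvNyc /= => ->; rewrite -[RHS]U_gt0.
by congr (P _); apply/seteqP; split => w /=; rewrite in_itv.
Qed.

Lemma all_positive_order_stats w : all_positive w -> forall i, 0 < V w i.
Proof.
move=> pw i; have [f _ fE] := order_stats_perm (fun k => U k w) n.
by rewrite fE; apply: pw => /=.
Qed.

(** Outcome weights are probabilities only for positive strengths. Cutting to this almost sure event
    gives values in [[0, 1]] everywhere and keeps the integral. *)
Definition cond_prob_pos (E : pred outcome) (w : T) : R :=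
  cond_prob (V w) E * \1_all_positive w.

Lemma cond_prob_pos_itv E w : 0 <= cond_prob_pos E w <= 1.
Proof.
rewrite /cond_prob_pos indicE; case: (boolP (w \in _)) => [|_].
  rewrite inE mulr1 => /all_positive_order_stats V0.
  by rewrite cond_prob_ge0//= cond_prob_le1.
by rewrite mulr0 lexx ler01.
Qed.

Lemma cond_prob_pos_measurable E : measurable_fun setT (cond_prob_pos E).
Proof.
apply: measurable_funM; first exact: cond_prob_measurable.
exact/measurable_indic/all_positive_measurable.
Qed.

Lemma integral_cond_prob_pos E :
  (\int[P]_w (cond_prob (V w) E)%:E = \int[P]_w (cond_prob_pos E w)%:E)%E.
Proof.
apply: ae_eq_integral => //.
- by apply/measurable_EFinP; exact: cond_prob_measurable.
- by apply/measurable_EFinP; exact: cond_prob_pos_measurable.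
exists (~` all_positive); split.
- exact/measurableC/all_positive_measurable.
- exact: all_positive_ae.
move=> w /= h pw; apply: h => _; rewrite /cond_prob_pos indicE mem_set//.
by rewrite mulr1.
Qed.

Lemma annealedE E :
  (annealed P (fun k => U k) E)%:E = (\int[P]_w (cond_prob_pos E w)%:E)%E.
Proof.
rewrite /annealed /Rintegral integral_cond_prob_pos fineK//.
rewrite ge0_fin_numE; last first.
  by apply: integral_ge0 => w _; rewrite lee_fin; have /andP[] := cond_prob_pos_itv E w.
apply: (@le_lt_trans _ _ (\int[P]_w (1%:E))%E); last first.
  rewrite integral_cst//= mul1e.
  exact: le_lt_trans (probability_le1 P measurableT) (ltry 1).
apply: ge0_le_integral => //.
- by move=> w _; rewrite lee_fin; have /andP[] := cond_prob_pos_itv E w.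
- by apply/measurable_EFinP; exact: cond_prob_pos_measurable.
- by move=> w _; rewrite lee_fin; have /andP[] := cond_prob_pos_itv E w.
Qed.

Lemma annealed_le (E F : pred outcome) : {subset E <= F} ->
  annealed P (fun k => U k) E <= annealed P (fun k => U k) F.
Proof.
move=> EF; rewrite -lee_fin !annealedE; apply: ge0_le_integral => //.
- by move=> w _; rewrite lee_fin; have /andP[] := cond_prob_pos_itv E w.
- by apply/measurable_EFinP; exact: cond_prob_pos_measurable.
- by apply/measurable_EFinP; exact: cond_prob_pos_measurable.
move=> w _; rewrite lee_fin /cond_prob_pos indicE.
case: (boolP (w \in _)) => [|_]; last by rewrite !mulr0.
rewrite inE !mulr1 => /all_positive_order_stats V0.
exact: cond_prob_le.
Qed.

Lemma annealed_le1 (E : pred outcome) : annealed P (fun k => U k) E <= 1.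
Proof.
rewrite -lee_fin annealedE.
apply: (@le_trans _ _ (\int[P]_w (1%:E))%E); last first.
  by rewrite integral_cst//= mul1e; exact: probability_le1.
apply: ge0_le_integral => //.
- by move=> w _; rewrite lee_fin; have /andP[] := cond_prob_pos_itv E w.
- by apply/measurable_EFinP; exact: cond_prob_pos_measurable.
- by move=> w _; rewrite lee_fin; have /andP[] := cond_prob_pos_itv E w.
Qed.

(** Integrate the pointwise bound of the indicator of [all_positive], an event of probability 1, by
    [cond_prob_pos E w + eta + \1_B w]. *)
Lemma annealed_ge (E : pred outcome) (B : set T) (eta : R) : measurable B ->
  0 <= eta ->
  (forall w, ~ B w -> (forall k, (k < n.+1)%N -> 0 < U k w) ->
     1 - eta <= cond_prob (V w) E) ->
  1 - eta - pr B <= annealed P (fun k => U k) E.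
Proof.
move=> mB eta0 H.
have PT : pr all_positive = 1.
  have mp := all_positive_measurable.
  have := probability_setC P (measurableC mp); rewrite setCK all_positive_ae.
  by move=> ->; rewrite sube0.
have : \sum_(q <- [:: (1 : R, all_positive)]) q.1 * pr q.2 <=
    annealed P (fun k => U k) E + eta + pr B.
  apply: (@weighted_le_integral _ _ _ P _
     (fun w => cond_prob_pos E w + (eta + \1_B w))).
  - move=> q; rewrite inE => /eqP -> /=; split=> //.
    exact: all_positive_measurable.
  - apply: measurable_funD; first exact: cond_prob_pos_measurable.
    by apply: measurable_funD; [exact: measurable_cst|exact: measurable_indic].
  - under eq_integral do rewrite EFinD EFinD.
    rewrite ge0_integralD//=.
    + rewrite ge0_integralD//=.
      * rewrite -annealedE integral_cst//= [P _]probability_setT mule1.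
        rewrite integral_indic// setIT !EFinD -pr_fin// addeA.
        exact: lexx.
      * by apply/measurable_EFinP; exact: measurable_indic.
    + by move=> w _; rewrite lee_fin; have /andP[] := cond_prob_pos_itv E w.
    + by apply/measurable_EFinP; exact: cond_prob_pos_measurable.
    + by move=> w _; rewrite -EFinD lee_fin addr_ge0// indicE.
    + apply: emeasurable_funD; first exact: measurable_cst.
      by apply/measurable_EFinP; exact: measurable_indic.
  - move=> w; rewrite big_seq1 /= mul1r.
    rewrite /cond_prob_pos !indicE; case: (boolP (w \in all_positive)) => [|_]; last first.
      by rewrite mulr0 !add0r addr_ge0.
    rewrite inE => /[dup] /all_positive_order_stats V0 pw.
    case: (boolP (w \in B)) => [_|].
      by have := cond_prob_ge0 V0 E; rewrite mulr1 /=; lra.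
    rewrite notin_setE => nB.
    by have := H _ nB (fun k kn => pw k kn); rewrite mulr1 /=; lra.
by rewrite big_seq1 /= PT; lra.
Qed.

End annealed_bounds.

(** * Second moments of the strengths *)

Section second_moment.
Context {d : measure_display} {T : measurableType d} {R : realType}.
Variables (P : probability T R) (U : nat -> {RV P >-> R}).
Hypothesis U_id : identically_distributed P (fun k => U k).
Hypothesis U_sqr : (\int[P]_w ((U 0%N w) ^+ 2)%:E < +oo)%E.

Local Notation pr A := (fine (P A)).

Lemma integral_sqr k :
  (\int[P]_w ((U k w) ^+ 2)%:E = \int[P]_w ((U 0%N w) ^+ 2)%:E)%E.
Proof.
pose g := fun x : R => (x ^+ 2)%:E.
have mg : measurable_fun [set: R] g by apply/measurable_EFinP; exact: measurable_funX.
have g0 x : (0 <= g x)%E by rewrite lee_fin sqr_ge0.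
have := ge0_integral_distribution (U k) mg g0 => <-.
have := ge0_integral_distribution (U 0%N) mg g0 => <-.
apply: eq_measure_integral => B mB _; exact: U_id.
Qed.

Lemma second_moment_bound : exists2 K : R, 0 < K &
  (forall k, (\int[P]_w ((U k w) ^+ 2)%:E <= K%:E)%E).
Proof.
exists (fine (\int[P]_w ((U 0%N w) ^+ 2)%:E)%E + 1) => [|k].
  by rewrite ltr_wpDl// fine_ge0// integral_ge0// => w _; rewrite lee_fin sqr_ge0.
rewrite integral_sqr EFinD fineK; last first.
  rewrite ge0_fin_numE// integral_ge0// => w _; by rewrite lee_fin sqr_ge0.
by rewrite leeDl// lee_fin.
Qed.

Lemma markov_sum_sqr (K s : R) (N : nat) : 0 < s ->
  (forall k, (\int[P]_w ((U k w) ^+ 2)%:E <= K%:E)%E) ->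
  pr [set w | s <= \sum_(k < N) U k w ^+ 2] <= N%:R * K / s.
Proof.
move=> s0 hK; rewrite ler_pdivlMr// mulrC.
have mU k : measurable_fun setT (fun w => U k w ^+ 2).
  by apply: measurable_funX; exact: measurable_funPT.
have mS : measurable_fun setT (fun w => \sum_(k < N) U k w ^+ 2).
  exact: measurable_sum.
have : \sum_(q <- [:: (s, [set w | s <= \sum_(k < N) U k w ^+ 2])]) q.1 * pr q.2
    <= N%:R * K.
  apply: (@weighted_le_integral _ _ _ P _ (fun w => \sum_(k < N) U k w ^+ 2)) => //.
  - move=> q; rewrite inE => /eqP -> /=; split; first exact: ltW.
    by apply: measurable_le_set => //; exact: measurable_cst.
  - under eq_integral do rewrite -sumEFin.
    rewrite ge0_integral_sum//.
    + apply: (@le_trans _ _ (\sum_(k < N) K%:E)%E); first exact: lee_sum.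
      by rewrite sumEFin sumr_const card_ord mulr_natl.
    + by move=> k; apply/measurable_EFinP.
    + by move=> k w _; rewrite lee_fin sqr_ge0.
  - move=> w; rewrite big_seq1 /= indicE.
    case: (boolP (w \in _)) => [|_]; first by rewrite inE mulr1.
    by rewrite mulr0 sumr_ge0// => k _; rewrite sqr_ge0.
by rewrite big_seq1.
Qed.

(** Markov's inequality for the square of a single strength. It provides the decay of the tail
    required by [convex_gap]. *)
Lemma tail_le_sqr (K x : R) : 0 < x ->
  (forall k, (\int[P]_w ((U k w) ^+ 2)%:E <= K%:E)%E) ->
  tail P (U 0%N) x * x ^+ 2 <= K.
Proof.
move=> x0 hK; have x20 : 0 < x ^+ 2 by rewrite exprn_gt0.
have := markov_sum_sqr 1 x20 hK; rewrite mul1r ler_pdivlMr//.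
apply: le_trans; apply: ler_wpM2r; [exact: ltW|rewrite /tail].
have mU : measurable_fun setT (U 0%N) by exact: measurable_funPT.
apply: pr_le.
- by apply: measurable_lt_set => //; exact: measurable_cst.
- apply: measurable_le_set; first exact: measurable_cst.
  by apply: measurable_sum => k; apply: measurable_funX; exact: measurable_funPT.
move=> w /= xU; rewrite big_ord1.
by rewrite ler_pXn2r// ?nnegrE; apply: ltW => //; exact: lt_trans xU.
Qed.

End second_moment.

(** * Decay of powers and stretched exponentials *)

Lemma natr_powRN_cvg0 {R : realType} (c : R) : 0 < c ->
  (n.+1%:R `^ (- c) : R) @[n --> \oo] --> (0 : R).
Proof.
move=> c0; apply/cvgrPdist_lt => e e0.
have h := near_infty_natSinv_lt (PosNum (powR_gt0 c^-1 e0)).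
near=> n; rewrite sub0r normrN ger0_norm ?powR_ge0//.
have : (n.+1%:R^-1 : R) < e `^ c^-1 by near: n.
move=> /(gt0_ltr_powR c0); rewrite !nnegrE invr_ge0 ler0n powR_ge0 => /(_ isT isT).
rewrite -powRrM mulVf ?gt_eqF// powRr1 ?(ltW e0)//.
by rewrite -powR_inv1// -powRrM mulN1r.
Unshelve. all: by end_near. Qed.

Lemma exp_powR_decay {R : realType} (c b : R) : 0 < c -> 0 < b ->
  exists2 K : R, 0 < K & forall x : R, 1 <= x ->
    x * expR (- (c * x `^ b)) <= K * x `^ (-1).
Proof.
(* The degree is such that [b * (m + 1) >= 2]: the term of degree [m + 1] of the exponential series
   then dominates [x ^+ 2]. *)
move=> c0 b0; pose m := Num.trunc (2 / b).
have mb : 2 <= b * m.+1%:R.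
  have := truncn_itv (divr_ge0 (ler0n R 2) (ltW b0)) => /andP[_].
  by rewrite ltr_pdivrMr// => /ltW; rewrite mulrC.
exists ((m.+1)`!%:R / c ^+ m.+1) => [|x x1].
  by rewrite divr_gt0 ?exprn_gt0// ltr0n fact_gt0.
have x0 : 0 < x by lra.
have y0 : 0 <= c * x `^ b by rewrite mulr_ge0 ?powR_ge0 ?ltW.
have := expR_ge1Dxn m y0.
have F0 : 0 < (m.+1)`!%:R :> R by rewrite ltr0n fact_gt0.
move: (_`!%:R) F0 => F F0 h.
have e0 : 0 < expR (c * x `^ b) by exact: expR_gt0.
have : (c * x `^ b) ^+ m.+1 / F <= expR (c * x `^ b) by lra.
rewrite exprMn -[(x `^ b) ^+ _]powR_mulrn ?powR_ge0// -powRrM.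
have : x ^+ 2 <= x `^ (b * m.+1%:R).
  by rewrite -powR_mulrn ?(ltW x0)//; exact: ler_powR.
move: (x `^ (b * _)) => z xz; rewrite ler_pdivrMr// => cz.
rewrite expRN powR_inv1 ?(ltW x0)// ler_pdivrMr//.
have C0 : 0 < c ^+ m.+1 by rewrite exprn_gt0.
move: (c ^+ m.+1) (expR _) C0 cz e0 => C e C0 cz e0.
have -> : F / C / x * e = (e * F) / (C * x) by field; rewrite !gt_eqF.
rewrite ler_pdivlMr ?mulr_gt0//; apply: le_trans cz.
have -> : x * (C * x) = C * x ^+ 2 by ring.
by rewrite ler_pM2l.
Qed.

(** * Separation of the strongest player *)

(** Union bound: if the last player does not win strictly, some other player scores at least as
    much. *)
Lemma cond_prob_strict_lb {R : realType} {n : nat} (V : 'I_n.+1 -> R) (L : R) :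
  (forall i, 0 < V i) -> 0 <= L ->
  (forall i, i != ord_max ->
     cond_prob V [pred x | (score x ord_max <= score x i)%N] <= L) ->
  1 - n.+1%:R * L <= cond_prob V (@last_wins_strictly n).
Proof.
move=> V0 L0 H; rewrite lerBlDr -[leLHS](cond_probT V0).
apply: (@le_trans _ _ (cond_prob V (@last_wins_strictly n) +
   \sum_(i | i != ord_max) cond_prob V [pred x | (score x ord_max <= score x i)%N])).
  rewrite /cond_prob.
  under [X in _ <= _ + X]eq_bigr do rewrite big_mkcond.
  rewrite exchange_big /= [X in _ <= X + _]big_mkcond -big_split /=.
  apply: ler_sum => x _; have w0 := outcome_weight_ge0 V0 x.
  have s0 : 0 <= \sum_(i | i != ord_max)
      (if (score x ord_max <= score x i)%N then outcome_weight V x else 0).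
    by apply: sumr_ge0 => i _; case: ifP.
  case: ifPn => [_|]; first by rewrite lerDl.
  rewrite negb_forall => /existsP[i]; rewrite negb_imply -leqNgt => /andP[im si].
  rewrite add0r (bigD1 i)//= si lerDl.
  by apply: sumr_ge0 => j _; case: ifP.
rewrite lerD2l; apply: (@le_trans _ _ (\sum_(i < n.+1) L)).
  rewrite big_mkcond; apply: ler_sum => i _; case: ifP => // im.
  exact: H.
by rewrite sumr_const card_ord mulr_natl.
Qed.

(** Deterministic part, for fixed strengths. [S] bounds the sum of squares, [F / 2] bounds the value
    of [f] at the top player, and [delta] separates values of [f] below [F]. Players up to [A] and
    beyond [A] are treated by the weak and the strong comparison. *)
Lemma strict_win_lb {R : realType} (n : nat) (u : nat -> R) (f : R -> R)
    (A d a b C kappa S F delta w c : R) :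
  0 < A -> 0 < d -> 0 < a -> 0 < b -> 0 < C -> 0 <= kappa ->
  (forall x y, x <= y -> f y <= f x) ->
  (forall y z, A <= y -> y <= z -> y ^+ 3 * (f y - f z) ^+ 2 <= C * (z - y) ^+ 2) ->
  (forall k, (k < n.+1)%N -> 0 < u k) ->
  kappa <= \sum_(k < n.+1) ((a <= u k <= b)%R)%:R ->
  \sum_(k < n.+1) u k ^+ 2 <= S ->
  (exists2 k, (k < n.+1)%N & f (u k) <= F / 2) ->
  0 <= delta -> delta <= F / 2 -> F / 2 < f (A + d) ->
  (forall k l, (k < n.+1)%N -> (l < n.+1)%N -> k != l ->
     f (u l) <= f (u k) -> f (u k) < F -> delta <= f (u k) - f (u l)) ->
  0 <= w -> 16 * w ^+ 2 * S <= 1 -> 4 * C * w <= delta ^+ 2 ->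
  c <= (kappa * (a * d / ((A + b) * (A + d + b)))) ^+ 2 / (16 * n.+1%:R) ->
  c <= kappa ^+ 2 * (a * A ^+ 2 / (A + b) ^+ 2) ^+ 2 * w / (16 * (n.+1%:R + S)) ->
  1 - n.+1%:R * expR (- c) <=
  cond_prob (@order_stats R n.+1 u) (@last_wins_strictly n).
Proof.
move=> A0 d0 a0 b0 C0 kap0 fni gap u0 kapP uS [k0 k0n fk0] de0 deF FA sep w0 wS wd c1 c2.
set V := @order_stats R n.+1 u.
have [s sinj sE] := order_stats_perm u n; rewrite -/V in sE.
have reix (g : R -> R) : \sum_(i < n.+1) g (V i) = \sum_(i < n.+1) g (u i).
  rewrite [RHS](reindex_inj sinj); apply: eq_bigr => i _.
  by rewrite sE.
have V0 i : 0 < V i by rewrite sE u0.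
have Vmax i : V i <= V ord_max by apply: order_stats_le; rewrite -ltnS.
have VS i : V i ^+ 2 <= S.
  apply: le_trans uS; rewrite -(reix (fun x => x ^+ 2)) (bigD1 i)//= lerDl.
  by apply: sumr_ge0 => j _; rewrite sqr_ge0.
have fmax : f (V ord_max) <= F / 2.
  apply: le_trans fk0; apply: fni.
  have : exists i, s i = Ordinal k0n.
    by have [t _ st] := injF_bij sinj; exists (t (Ordinal k0n)).
  move=> [i si]; have : V i = u k0 by rewrite sE si.
  by move=> <-.
(* Otherwise [f] at the top player would be at least [f (A + d) > F / 2]. *)
have Amax : A + d <= V ord_max.
  rewrite leNgt; apply/negP => /ltW /fni h.
  by have := lt_le_trans FA h; rewrite ltNge fmax.
have kapV : kappa <= \sum_(j < n.+1) ((a <= V j <= b)%R)%:R.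
  by rewrite (reix (fun x => ((a <= x <= b)%R)%:R)).
have sumV : \sum_(j < n.+1) V j <= n.+1%:R + S.
  have -> : n.+1%:R = \sum_(j < n.+1) (1 : R) by rewrite sumr_const card_ord.
  apply: (@le_trans _ _ (\sum_(j < n.+1) (1 + V j ^+ 2))).
    apply: ler_sum => j _; have := sqr_ge0 (V j - 2^-1).
    by have := sqr_ge0 (V j); lra.
  by rewrite big_split /= lerD2l (reix (fun x => x ^+ 2)).
apply: cond_prob_strict_lb => //.
move=> i im; have [iA|Ai] := leP (V i) A.
  apply: le_trans (cond_prob_upset_weak V0 im (Vmax i) a0 b0 kap0 kapV A0 d0 iA Amax) _.
  by rewrite ler_expR lerN2.
(* If [f (V i)] is at least [F], the gap is at least [F / 2 >= delta]; below [F] the separation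
   hypothesis applies. *)
have gapi : delta <= f (V i) - f (V ord_max).
  have [Fi|iF] := leP F (f (V i)); first lra.
  rewrite sE [V _ in X in _ <= _ - X]sE.
  apply: sep; rewrite -?sE ?fni//.
  by apply: contra im => /eqP e; apply/eqP/sinj/val_inj.
(* Squared, this follows from [V i ^+ 2 <= S] and [16 * w ^+ 2 * S <= 1]. *)
have wVi : 4 * w * V i <= 1.
  rewrite -(ler_pXn2r (_ : 0 < 2)%N) ?nnegrE ?mulr_ge0 ?(ltW (V0 i))// expr1n.
  apply: le_trans wS; rewrite exprMn exprMn.
  have -> : 4 ^+ 2 * w ^+ 2 * V i ^+ 2 = 16 * w ^+ 2 * V i ^+ 2 by ring.
  by rewrite ler_wpM2l// mulr_ge0// sqr_ge0.
have gap2 : V i ^+ 3 * delta ^+ 2 <= C * (V ord_max - V i) ^+ 2.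
  apply: le_trans (gap _ _ (ltW Ai) (Vmax i)).
  rewrite ler_wpM2l ?exprn_ge0 ?(ltW (V0 i))// ler_pXn2r ?nnegrE//.
  exact: le_trans gapi.
apply: le_trans (cond_prob_upset_strong V0 im (Vmax i) a0 b0 kap0 kapV A0 C0
  (ltW Ai) sumV gap2 w0 wVi wd) _.
by rewrite ler_expR lerN2.
Qed.

(** * Levels of the tail and separation of the values of [f] *)

Section tails.
Context {d : measure_display} {T : measurableType d} {R : realType}.
Variables (P : probability T R) (U : nat -> {RV P >-> R}).
Hypothesis U_ind : mutually_independent P (fun k => U k).
Hypothesis U_id : identically_distributed P (fun k => U k).

Local Notation pr A := (fine (P A)).
Local Notation Q := (tail P (U 0%N)).

Lemma tail_measurable x : measurable [set w | x < U 0%N w].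
Proof.
by apply: measurable_lt_set; [exact: measurable_cst|exact: measurable_funPT].
Qed.

Lemma tail_ge0 x : 0 <= Q x.
Proof. by rewrite /tail fine_ge0. Qed.

Lemma tail_le1 x : Q x <= 1.
Proof.
rewrite -lee_fin /tail -pr_fin; last exact: tail_measurable.
exact/probability_le1/tail_measurable.
Qed.

Lemma tail_nonincreasing x y : x <= y -> Q y <= Q x.
Proof.
move=> xy; apply: pr_le; [exact: tail_measurable|exact: tail_measurable|].
by move=> w /=; exact: le_lt_trans.
Qed.

Lemma pr_preimageI k l (B : set R) : measurable B -> k != l ->
  pr (U k @^-1` B `&` U l @^-1` B) = pr (U 0%N @^-1` B) ^+ 2.
Proof.
move=> mB kl; have := U_ind (s := [:: k; l]) (B := fun=> B).
rewrite !big_cons !big_nil setIT mule1 => -> //; last by rewrite /= inE andbT kl.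
have mU j : measurable (U j @^-1` B).
  by rewrite -[X in measurable X]setTI; exact: measurable_funPT.
rewrite fineM ?fin_num_measure// -(pr_preimage U_id k mB) expr2.
by rewrite [in RHS](U_id k mB) -[in X in _ = X * _](U_id l mB) (U_id l mB) (U_id k mB).
Qed.

Lemma chebyshev_RV (B : set R) (p : R) (N : nat) : measurable B ->
  pr (U 0%N @^-1` B) = p -> 0 < p -> (0 < N)%N ->
  measurable [set w | \sum_(k < N) \1_(U k @^-1` B) w <= N%:R * p / 2] /\
  pr [set w | \sum_(k < N) \1_(U k @^-1` B) w <= N%:R * p / 2] <= 4 / (N%:R * p).
Proof.
move=> mB pE p0 N0; apply: (chebyshev_count (A := fun k => U k @^-1` B)) => //.
- by move=> k; rewrite -[X in measurable X]setTI; exact: measurable_funPT.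
- by move=> k; rewrite (pr_preimage U_id).
- by move=> k l kl; rewrite pr_preimageI// pE.
Qed.

Lemma norm_lt_measurable x e : measurable [set w | `|U 0%N w - x| < e].
Proof.
apply: measurable_lt_set; last exact: measurable_cst.
apply: (measurableT_comp (@measurable_realfun.normr_measurable R setT)).
by apply: measurable_funB; [exact: measurable_funPT|exact: measurable_cst].
Qed.

Lemma law_support_pos x e : law_support P (U 0%N) x -> 0 < e ->
  0 < pr [set w | `|U 0%N w - x| < e].
Proof.
move=> sx e0; have := sx e e0; rewrite pr_fin ?lte_fin//.
exact: norm_lt_measurable.
Qed.

(** A support point to the right of [x0] keeps the tail positive beyond some [A > x0]. The support
    point [x0] itself gives mass to an interval [[a, b]], which supplies a number of opponents of
    order [N]. *)
Lemma law_support_interior x0 : 0 < x0 ->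
  interior (law_support P (U 0%N)) x0 ->
  (exists A e, [/\ x0 < A, 0 < e & 0 < Q (A + e)]) /\
  (exists a b, [/\ 0 < a, 0 < b & 0 < pr (U 0%N @^-1` `[a, b]%classic)]).
Proof.
move=> x00 /[dup] /interior_subset s0 /nbhs_ballP[e /= e0 be]; split.
  exists (x0 + e / 4), (e / 4).
  have e4 : 0 < e / 4 by rewrite divr_gt0.
  split=> //; first lra.
  have : law_support P (U 0%N) (x0 + 3 * (e / 4)).
    by apply: be; rewrite /ball /= opprD addNKr normrN gtr0_norm; lra.
  move=> /law_support_pos /(_ e4) h; apply: lt_le_trans h _.
  apply: pr_le; [exact: norm_lt_measurable|exact: tail_measurable|].
  by move=> w /=; rewrite ltr_norml => /andP[h _]; lra.
have x2 : 0 < x0 / 2 by rewrite divr_gt0.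
exists (x0 / 2), (3 * (x0 / 2)); split=> //; first lra.
apply: lt_le_trans (law_support_pos s0 x2) _.
apply: pr_le; [exact: norm_lt_measurable| |].
  by rewrite -[X in measurable X]setTI; exact: measurable_funPT.
by move=> w /=; rewrite ltr_norml in_itv /= => /andP[h1 h2]; apply/andP; split; lra.
Qed.

Context (g x0 A K : R).
Hypothesis g4 : 4^-1 <= g.
Hypothesis g2 : g < 2^-1.
Hypothesis x0A : x0 < A.
Hypothesis K0 : 0 < K.
Hypothesis QK : forall x, 0 < x -> Q x * x ^+ 2 <= K.

Let f (x : R) := Q x `^ g.
Let r := g^-1.
Hypothesis fconv : convex_on_from f x0.

Lemma exponent_gt0 : 0 < g.
Proof. by apply: lt_le_trans g4; rewrite invr_gt0. Qed.

Lemma tail_powR_nonincreasing x y : x <= y -> f y <= f x.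
Proof.
move=> xy; apply: ge0_ler_powR; rewrite ?nnegrE ?tail_ge0//; first exact/ltW/exponent_gt0.
exact: tail_nonincreasing.
Qed.

(** Since [2 * g >= 1 / 2] and [Q <= 1], the square of [f] is at most the square root of [Q]. The
    bound [K + 1] dominates the square root of [K]. *)
Lemma tail_powR_sqr x : 0 < x -> f x ^+ 2 * x <= K + 1.
Proof.
have g40 := g4; have Kp := K0; move=> xp; have := tail_ge0 x; rewrite le_eqVlt => /orP[/eqP q0|q0].
  by rewrite /f -q0 powR0 ?gt_eqF ?exponent_gt0// expr0n mul0r; lra.
set q := Q x `^ 2^-1.
have qE : q ^+ 2 = Q x.
  by rewrite -powR_mulrn ?powR_ge0// -powRrM mulVf// powRr1// ltW.
have fq : f x ^+ 2 <= q.
  rewrite -powR_mulrn ?powR_ge0// -powRrM; apply: ger_powR; last lra.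
  by rewrite q0 tail_le1.
apply: (@le_trans _ _ (q * x)); first by rewrite ler_wpM2r// ltW.
rewrite -(ler_pXn2r (_ : 0 < 2)%N) ?nnegrE//; last 2 first.
- by rewrite mulr_ge0 ?powR_ge0// ltW.
- by lra.
rewrite exprMn qE; apply: le_trans (QK xp) _.
have -> : (K + 1) ^+ 2 = K ^+ 2 + 2 * K + 1 by ring.
by have := sqr_ge0 K; lra.
Qed.

Lemma tail_powR_quantile t : 0 < t -> t <= f A ->
  exists x, [/\ A <= x, f x = t & Q x = t `^ r].
Proof.
move=> t0 tA; have [|x Ax fx] := convex_on_from_ivt fconv x0A
    tail_powR_nonincreasing _ tA.
  have K1 : 0 < K + 1 by have := K0; lra.
  have y0 : 0 < (K + 1) / t ^+ 2 by rewrite divr_gt0// exprn_gt0.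
  (* At this point [tail_powR_sqr] reads [f x ^+ 2 <= t ^+ 2], so [f] has fallen to level [t]. *)
  exists ((K + 1) / t ^+ 2).
  rewrite -(ler_pXn2r (_ : 0 < 2)%N) ?nnegrE ?powR_ge0// ?(ltW t0)//.
  have := tail_powR_sqr y0; rewrite mulrA ler_pdivrMr ?exprn_gt0//.
  by rewrite mulrC ler_pM2l.
exists x; split=> //.
rewrite -fx /f /r -powRrM divff ?powRr1 ?tail_ge0// gt_eqF//; exact: exponent_gt0.
Qed.

(** Values of [f] between [s] and [t] force [u] into an interval between two quantiles, of mass
    [t ^ r - s ^ r]. For [s = 0] the interval is unbounded and also covers the points where [f]
    vanishes. *)
Lemma level_cell s t : 0 <= s -> s < t -> t <= f A -> exists B : set R,
  [/\ measurable B, pr (U 0%N @^-1` B) <= t `^ r - s `^ r &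
    forall u, (0 < s -> s < f u) -> f u < t -> B u].
Proof.
have rN0 : r != 0 by rewrite /r invr_eq0 gt_eqF//; exact: exponent_gt0.
move=> s0 st tA; have t0 : 0 < t by exact: le_lt_trans st.
have [x [Ax fx Qx]] := tail_powR_quantile t0 tA.
have Bt u : f u < t -> x < u.
  move=> fu; rewrite ltNge; apply/negP => /tail_powR_nonincreasing.
  by rewrite fx leNgt fu.
move: s0; rewrite le_eqVlt => /orP[/eqP s0|s0].
  exists `]x, +oo[%classic; split.
  - exact: measurable_itv.
  - rewrite -s0 powR0// subr0 -Qx /tail le_eqVlt; apply/orP; left; apply/eqP.
    by congr (fine (P _)); apply/seteqP; split => w /=; rewrite in_itv/= andbT.
  - by move=> u _ /Bt; rewrite /= in_itv/= andbT.
have [y [Ay fy Qy]] := tail_powR_quantile s0 (ltW (lt_le_trans st tA)).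
exists `]x, y]%classic; split.
- exact: measurable_itv.
- rewrite -Qx -Qy /tail.
  have xy : x <= y.
    rewrite leNgt; apply/negP => /ltW /tail_powR_nonincreasing.
    by rewrite fx fy leNgt st.
  have -> : U 0%N @^-1` `]x, y]%classic =
      [set w | x < U 0%N w] `\` [set w | y < U 0%N w].
    apply/seteqP; split => w /=; rewrite in_itv/=.
      by move=> /andP[xw wy]; split=> //; apply/negP; rewrite -leNgt.
    by move=> [xw /negP]; rewrite -leNgt xw.
  rewrite measureD; [|exact: tail_measurable|exact: tail_measurable|]; last first.
    by rewrite ltey_eq fin_num_measure//; exact: tail_measurable.
  have -> : [set w | x < U 0%N w] `&` [set w | y < U 0%N w] = [set w | y < U 0%N w].
    by apply/seteqP; split => w /= => [[]//|h]; split=> //; exact: le_lt_trans h.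
  by rewrite fineB ?fin_num_measure//; exact: tail_measurable.
- move=> u /(_ s0) su /Bt xu; rewrite /= in_itv/= xu /= leNgt; apply/negP.
  by move=> /ltW /tail_powR_nonincreasing; rewrite fy leNgt su.
Qed.

Lemma exponent_itv : 2 < r <= 4.
Proof.
rewrite /r -[X in X < _]invrK -[X in _ <= X]invrK.
by rewrite ltf_pV2 ?lef_pV2 ?posrE ?invr_gt0 ?exponent_gt0// g2 g4.
Qed.

(* [t `^ r] is the probability of [f U < t], so a window of [f]-values of length
   [3 delta] below [2 F] has probability of order [delta * F `^ (r - 1)]; two
   players closer than [delta] share one of the [O(F / delta)] windows. *)
Lemma close_pairs (N : nat) (F delta : R) : 0 < delta -> delta <= F / 2 ->
  2 * F <= f A -> exists B : set T,
  [/\ measurable B,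
    pr B <= N%:R ^+ 2 * (2 * F / delta) * (12 * delta * (2 * F) `^ (r - 1)) ^+ 2 &
    forall w, ~ B w -> forall k l, (k < N)%N -> (l < N)%N -> k != l ->
      f (U l w) <= f (U k w) -> f (U k w) < F -> delta <= f (U k w) - f (U l w)].
Proof.
move=> de0 deF FA; have F0 : 0 < F by lra.
have /andP[r2 r4] := exponent_itv; have r0 : 0 < r by lra.
(* Number of cells of length [delta] meeting [[0, F]]. As [delta <= F], the added 1 is absorbed in
   the factor 2 of [ME]. *)
pose M := (Num.trunc (F / delta)).+1.
have ME : M%:R <= 2 * F / delta.
  have : (Num.trunc (F / delta))%:R <= F / delta by rewrite truncn_le divr_ge0// ltW.
  rewrite /M -natr1 -mulrA mulr_natl mulr2n => h; apply: lerD => //.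
  by rewrite ler_pdivlMr// mul1r; lra.
pose q := 12 * delta * (2 * F) `^ (r - 1).
(* The window starts one cell early because [level_cell] needs a strict lower bound. For [j = 0] the
   predecessor is 0, where no lower bound is required. *)
have /choice[B BP] (j : 'I_M) : exists B : set R,
    [/\ measurable B, pr (U 0%N @^-1` B) <= q &
      forall u, j%:R * delta <= f u -> f u < j.+2%:R * delta -> B u].
  have jF : j%:R * delta <= F.
    rewrite -ler_pdivlMr//; apply: le_trans (_ : (Num.trunc (F / delta))%:R <= _).
      by rewrite ler_nat -ltnS.
    by rewrite truncn_le divr_ge0// ltW.
  have s0 : 0 <= j.-1%:R * delta by rewrite mulr_ge0// ltW.
  have st : j.-1%:R * delta < j.+2%:R * delta.
    by rewrite ltr_pM2r// ltr_nat ltnS (leq_trans (leq_pred _)).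
  have tF : j.+2%:R * delta <= 2 * F.
    by rewrite -addn2 natrD mulrDl; lra.
  have [B [mB pB inB]] := level_cell s0 st (le_trans tF FA).
  exists B; split=> //.
    apply: le_trans pB _; have t0 : 0 < j.+2%:R * delta by rewrite mulr_gt0.
    apply: le_trans (powR_sub_le s0 (ltW st) t0 r0 r4) _.
    have h1 : (j.+2%:R * delta) `^ (r - 1) <= (2 * F) `^ (r - 1).
      apply: ge0_ler_powR; rewrite ?nnegrE ?(ltW t0) ?mulr_ge0 ?(ltW F0)//.
      by lra.
    have h2 : j.+2%:R * delta - j.-1%:R * delta <= 3 * delta.
      rewrite -mulrBl ler_pM2r//.
      have : (j.+2 <= j.-1 + 3)%N by case: (nat_of_ord j) => // i; rewrite addn3.
      by rewrite -(ler_nat R) natrD; lra.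
    rewrite /q; have p0 : 0 <= (2 * F) `^ (r - 1) by exact: powR_ge0.
    apply: (@le_trans _ _ (4 * (2 * F) `^ (r - 1) * (3 * delta))); last lra.
    apply: ler_pM => //; first by rewrite mulr_ge0 ?powR_ge0.
    + by rewrite subr_ge0 ltW.
    + by rewrite ler_pM2l.
  move=> u ju uj; apply: inB => // sj; apply: lt_le_trans ju.
  rewrite ltr_pM2r// ltr_nat; case: (nat_of_ord j) sj => //.
  by rewrite mul0r ltxx.
have mU j k : measurable (U k @^-1` B j).
  by rewrite -[X in measurable X]setTI; apply: measurable_funPT => //; have [] := BP j.
pose Z (t : 'I_N * 'I_N * 'I_M) : set T :=
  if t.1.1 == t.1.2 then set0 else U t.1.1 @^-1` B t.2 `&` U t.1.2 @^-1` B t.2.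
have mZ t : measurable (Z t).
  by rewrite /Z; case: ifP => _ //; exact: measurableI.
exists (\bigcup_t Z t); split.
- by apply: fin_bigcup_measurable => //; exact: finite_finset.
- apply: le_trans (pr_bigcup_le P mZ) _.
  apply: (@le_trans _ _ (\sum_(t : 'I_N * 'I_N * 'I_M) q ^+ 2)).
    apply: ler_sum => -[[k l] j] _; rewrite /Z /=; case: ifPn => [_|kl].
      by rewrite measure0 sqr_ge0.
    have [mB pB _] := BP j; rewrite pr_preimageI//.
    have p0 : 0 <= pr (U 0%N @^-1` B j) by rewrite fine_ge0.
    by rewrite ler_pXn2r ?nnegrE// (le_trans p0).
  rewrite sumr_const !card_prod !card_ord -[_ *+ _]mulr_natl natrM natrM -/q -expr2.
  by rewrite ler_wpM2r ?sqr_ge0// ler_wpM2l ?sqr_ge0.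
move=> w nB k l kN lN kl lk kF; rewrite leNgt; apply/negP => close.
have fl0 : 0 <= f (U l w) / delta by rewrite divr_ge0 ?powR_ge0// ltW.
(* [j] is the cell of the smaller value; the larger one, less than [delta] above, stays below the
   end of cell [j + 1]. *)
have /andP[j1 j2] := truncn_itv fl0; set j := Num.trunc _ in j1 j2.
have jM : (j < M)%N.
  by rewrite ltnS /j le_truncn// ler_pM2r ?invr_gt0//; lra.
apply: nB; exists (Ordinal kN, Ordinal lN, Ordinal jM) => //.
rewrite /Z /= -val_eqE /= (negbTE kl).
have [_ _ inB] := BP (Ordinal jM).
have jl : j%:R * delta <= f (U l w) by rewrite -ler_pdivlMr.
have lj : f (U l w) < j.+1%:R * delta by rewrite -ltr_pdivrMr.
have e2 : j.+2%:R * delta = j.+1%:R * delta + delta by rewrite -[in LHS]natr1 mulrDl mul1r.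
by split; apply: inB => /=; rewrite ?e2; lra.
Qed.

End tails.

(** * Choice of the exponents and estimates in powers of [N] *)

Lemma pair_bound_rate {R : realType} (x g e : R) :
  1 <= x -> 4^-1 <= g -> g < 2^-1 -> 0 < e ->
  x ^+ 2 * (2 * (2 * x `^ (e - g)) / x `^ (- g - 8 * e)) *
    (12 * x `^ (- g - 8 * e) * (2 * (2 * x `^ (e - g))) `^ (g^-1 - 1)) ^+ 2 <=
  576 * (4 `^ (g^-1 - 1)) ^+ 2 * x `^ (- e).
Proof.
move=> x1 g4 g2 e0; have x0 : 0 < x by lra.
have /andP[r2 r4] := exponent_itv g4 g2.
have gr : g * g^-1 = 1 by rewrite divff// gt_eqF//; lra.
move: (g^-1) r2 r4 gr => r r2 r4 gr.
have ED y z : x `^ y * x `^ z = x `^ (y + z).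
  by rewrite powRD//; apply/implyP => _; rewrite gt_eqF.
have -> : 2 * (2 * x `^ (e - g)) = 4 * x `^ (e - g) by ring.
rewrite powRM ?powR_ge0// -powRrM.
set H := 4 `^ _.
have -> : x ^+ 2 * (4 * x `^ (e - g) / x `^ (- g - 8 * e)) *
     (12 * x `^ (- g - 8 * e) * (H * x `^ ((e - g) * (r - 1)))) ^+ 2 =
     576 * H ^+ 2 * x `^ (2 * (e * r) - 9 * e).
  (* As [g * r = 1], the powers collect to [2 * e * r - 9 * e], which is at most [- e] because
     [r <= 4]. *)
  have -> : 2 * (e * r) - 9 * e = 2 + (e - g) + (- g - 8 * e) +
      ((e - g) * (r - 1) + (e - g) * (r - 1)) by lra.
  have -> : x ^+ 2 = x `^ 2 by rewrite -powR_mulrn// ltW.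
  rewrite -[in RHS]ED -[in RHS]ED -[x `^ (2 + _)]ED -[x `^ (_ + (e - g) * _)]ED.
  have : x `^ (- g - 8 * e) != 0 by rewrite gt_eqF// powR_gt0.
  move: (x `^ (- g - 8 * e)) (x `^ ((e - g) * (r - 1))) (x `^ (e - g)) (x `^ 2).
  by move=> u v w z u0; field.
have : 0 <= 576 * H ^+ 2 by rewrite mulr_ge0 ?ler0n// sqr_ge0.
move: (576 * H ^+ 2) => G G0; rewrite ler_wpM2l// ler_powR//.
have : e * r <= e * 4 by rewrite ler_wpM2l// ltW.
by clear -e0; lra.
Qed.

(** With [S = N ^ (1 + e)] and [w] of order [N ^ (- 2 g - 16 e)], the strong exponent
    [N ^ 2 * w / S] has order [N ^ (1 - 2 g - 17 e)], that is [N ^ (17 e)] since [1 - 2 g = 34 e].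
    The weak exponent has order [N], which is larger. *)
Lemma strict_win_rate {R : realType} (f : R -> R) (A D a b p C g e : R) :
  0 < A -> 0 < D -> 0 < a -> 0 < b -> 0 < p -> 0 < C ->
  4^-1 <= g -> 0 < e -> g = 2^-1 - 17 * e ->
  (forall x y, x <= y -> f y <= f x) ->
  (forall y z, A <= y -> y <= z -> y ^+ 3 * (f y - f z) ^+ 2 <= C * (z - y) ^+ 2) ->
  exists2 c, 0 < c & forall (n : nat) (u : nat -> R),
    let N : R := n.+1%:R in
    (forall k, (k < n.+1)%N -> 0 < u k) ->
    N * p / 2 <= \sum_(k < n.+1) ((a <= u k <= b)%R)%:R ->
    \sum_(k < n.+1) u k ^+ 2 <= N `^ (1 + e) ->
    (exists2 k, (k < n.+1)%N & f (u k) <= N `^ (e - g)) ->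
    N `^ (e - g) < f (A + D) ->
    (forall k l, (k < n.+1)%N -> (l < n.+1)%N -> k != l -> f (u l) <= f (u k) ->
       f (u k) < 2 * N `^ (e - g) -> N `^ (- g - 8 * e) <= f (u k) - f (u l)) ->
    1 - N * expR (- (c * N `^ (17 * e))) <=
    cond_prob (@order_stats R n.+1 u) (@last_wins_strictly n).
Proof.
move=> A0 D0 a0 b0 p0 C0 g4 e0 gE fni gap.
pose k1 := a * D / ((A + b) * (A + D + b)).
have k10 : 0 < k1 by rewrite /k1 divr_gt0 ?mulr_gt0 ?addr_gt0.
pose k2 := a * A ^+ 2 / (A + b) ^+ 2.
have k20 : 0 < k2 by rewrite /k2 divr_gt0 ?mulr_gt0 ?exprn_gt0 ?addr_gt0.
(* The two entries serve the two conditions on [w]: [16 * w ^+ 2 * S <= 1] and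
   [4 * C * w <= delta ^+ 2]. *)
pose c3 := Num.min 4^-1 (4 * C)^-1.
have c30 : 0 < c3 by rewrite /c3 lt_min !invr_gt0 ltr0n mulr_gt0.
have c34 : c3 <= 4^-1 by rewrite /c3 ge_min lexx.
have c3C : 4 * C * c3 <= 1.
  by rewrite mulrC -ler_pdivlMr ?mulr_gt0// mul1r /c3 ge_min lexx orbT.
clearbody c3.
pose K1 := (p * k1 / 2) ^+ 2 / 16; pose K2 := (p * k2 / 2) ^+ 2 * c3 / 32.
have K10 : 0 < K1 by rewrite /K1 divr_gt0// exprn_gt0// divr_gt0// mulr_gt0.
have K20 : 0 < K2.
  by rewrite /K2 divr_gt0// mulr_gt0// exprn_gt0// divr_gt0// mulr_gt0.
exists (Num.min K1 K2) => [|n u N]; first by rewrite lt_min K10 K20.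
have c0 : 0 <= Num.min K1 K2 by rewrite le_min !ltW.
have N1 : 1 <= N by rewrite ler1n.
have N0 : 0 < N by rewrite ltr0n.
pose E x := N `^ x.
have ED x y : E x * E y = E (x + y).
  by rewrite /E powRD//; apply/implyP => _; rewrite gt_eqF.
have EV x : (E x)^-1 = E (- x) by rewrite /E powRN.
have Epos x : 0 < E x by exact: powR_gt0.
have Ele x y : x <= y -> E x <= E y by move=> xy; exact: ler_powR.
have E1 : E 1 = N by rewrite /E powRr1// ltW.
have E0 : E 0 = 1 by rewrite /E powRr0.
move=> pos cnt sqr top FA sep.
pose W := c3 * E (- (2 * g) - 16 * e).
have W0 : 0 <= W by rewrite mulr_ge0// ltW.
have F2 : 2 * N `^ (e - g) / 2 = E (e - g) by rewrite mulrAC divff// mul1r.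
apply: (@strict_win_lb R n u f A D a b C (N * p / 2) (E (1 + e)) (2 * E (e - g))
    (E (- g - 8 * e)) W) => //.
- by rewrite divr_ge0 ?mulr_ge0// ltW.
- by rewrite F2.
- exact/ltW/Epos.
- by rewrite F2; apply: Ele; clear -e0; lra.
- by rewrite F2.
- have -> : 16 * W ^+ 2 * E (1 + e) = 16 * c3 ^+ 2 * E (1 - 4 * g - 31 * e).
    have -> : E (1 - 4 * g - 31 * e) =
        E (- (2 * g) - 16 * e) * E (- (2 * g) - 16 * e) * E (1 + e).
      by rewrite !ED; congr E; clear; lra.
    by rewrite /W; ring.
  (* The exponent is negative because [g >= 1 / 4]. *)
  have h1 : E (1 - 4 * g - 31 * e) <= 1.
    by rewrite -[leRHS]E0; apply: Ele; clear -e0 g4; lra.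
  have h2 : 16 * c3 ^+ 2 <= 1.
    have : c3 ^+ 2 <= 4^-1 ^+ 2 by rewrite ler_pXn2r ?nnegrE// ltW.
    by clear; lra.
  apply: le_trans (_ : 1 * 1 <= 1); last by rewrite mulr1.
  by apply: ler_pM => //; rewrite ?mulr_ge0 ?sqr_ge0// ltW.
- rewrite /W mulrA -[leRHS]mul1r expr2 ED.
  have -> : - g - 8 * e + (- g - 8 * e) = - (2 * g) - 16 * e by clear; lra.
  by rewrite ler_wpM2r// ltW.
- rewrite -/k1 -/N.
  have -> : (N * p / 2 * k1) ^+ 2 / (16 * N) = K1 * E 1.
    by rewrite E1 /K1; field; rewrite gt_eqF.
  apply: ler_pM => //; first exact/ltW/Epos.
    by rewrite ge_min lexx.
  by apply: Ele; clear -g4 gE; lra.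
- rewrite -/k2 -/N.
  have NS : N <= E (1 + e) by rewrite -E1; apply: Ele; clear -e0; lra.
  have S0 := Epos (1 + e).
  apply: (@le_trans _ _ ((N * p / 2) ^+ 2 * k2 ^+ 2 * W / (32 * E (1 + e)))).
    have -> : (N * p / 2) ^+ 2 * k2 ^+ 2 * W / (32 * E (1 + e)) = K2 * E (17 * e).
      have -> : E (17 * e) = E 1 * E 1 * E (- (2 * g) - 16 * e) * E (- (1 + e)).
        by rewrite !ED; congr E; clear -gE; lra.
      by rewrite -EV E1 /K2 /W; field; rewrite gt_eqF.
    by rewrite ler_wpM2r ?(ltW (Epos _))// ge_min lexx orbT.
  apply: ler_wpM2l; first by apply: mulr_ge0 => //; apply: mulr_ge0; exact: sqr_ge0.
  by rewrite lef_pV2 ?posrE ?mulr_gt0 ?addr_gt0//; clear -NS; lra.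
Qed.

(** Four bad events are removed: [B1], the sum of squares is too large; [B2], too few strengths lie
    in [[a, b]]; [B3], too few strengths exceed a high quantile; [B4], two small values of [f] are
    too close. Each has probability of order at most [N ^ (- e)], and outside them [strict_win_rate]
    applies. *)
Lemma annealed_strict_lb {d : measure_display} {T : measurableType d}
    {R : realType} (P : probability T R) (U : nat -> {RV P >-> R})
    (g x0 A D a b K : R) :
  mutually_independent P (fun k => U k) ->
  identically_distributed P (fun k => U k) ->
  P [set w | U 0%N w <= 0] = 0%E ->
  (forall k, (\int[P]_w ((U k w) ^+ 2)%:E <= K%:E)%E) -> 0 < K ->
  4^-1 <= g -> g < 2^-1 ->
  0 < x0 -> x0 < A -> 0 < D -> 0 < tail P (U 0%N) (A + D) ->
  0 < a -> 0 < b -> 0 < fine (P (U 0%N @^-1` `[a, b]%classic)) ->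
  convex_on_from (fun x => tail P (U 0%N) x `^ g) x0 ->
  exists M e : R, 0 < e /\ \forall n \near \oo,
    1 - M * n.+1%:R `^ (- e) <=
    annealed P (fun k => U k) (@last_wins_strictly n).
Proof.
move=> U_ind U_id U_gt0 UK K0 g4 g2 x00 x0A D0 QAD a0 b0.
set p := fine _ => p0 fconv.
set Q := tail P (U 0%N) in QAD fconv *; pose f x := Q x `^ g.
have g0 : 0 < g by clear -g4; lra.
have A0 : 0 < A by exact: lt_trans x0A.
have QK x : 0 < x -> Q x * x ^+ 2 <= K by move=> xp; apply: tail_le_sqr.
have fni : forall x y, x <= y -> f y <= f x.
  by move=> x y; exact: (@tail_powR_nonincreasing _ _ _ P U g g4).
have [C C0 gap] : exists2 C, 0 < C & forall y z, A <= y -> y <= z ->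
    y ^+ 3 * (f y - f z) ^+ 2 <= C * (z - y) ^+ 2.
  have [||C C0 CP] := convex_gap fconv (K := K + 1) x00 x0A (addr_gt0 K0 ltr01).
  - by move=> x _; exact: powR_ge0.
  - move=> x xx; apply: (@tail_powR_sqr _ _ _ P U g K g4 K0 QK).
    exact: lt_le_trans xx.
  - by exists C => // y z Ay yz; apply: CP => //; exact: fni.
pose e := (2^-1 - g) / 17.
have e0 : 0 < e by rewrite divr_gt0// subr_gt0.
have gE : g = 2^-1 - 17 * e by rewrite /e; clear; lra.
clearbody e; pose r := g^-1.
have /andP[r2 r4] : 2 < r <= 4 by exact: exponent_itv.
have gr : g * r = 1 by rewrite /r divff// gt_eqF.
have [c c0 rate] := strict_win_rate A0 D0 a0 b0 p0 C0 g4 e0 gE fni gap.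
have h0 : 0 < 17 * e by rewrite mulr_gt0.
have [Kd Kd0 decay] := exp_powR_decay c0 h0.
pose H := 576 * ((4 : R) `^ (r - 1)) ^+ 2.
(* The constants come from [eta], [B1], [B2], [B3] and [B4], in this order. *)
exists (Kd + (K + (4 / p + (4 + H)))), e; split=> //.
have fAD : 0 < f (A + D) by exact: powR_gt0.
(* For large [N] all the levels of [f] that occur, up to [4 * N ^ (e - g)], lie below [f (A + D)],
   hence in the range where convexity is available. *)
have near_small : \forall n \near \oo, n.+1%:R `^ (- (g - e)) < f (A + D) / 4.
  have ge0 : 0 < g - e by clear -gE g4 e0; lra.
  have /cvgrPdist_lt /(_ (f (A + D) / 4)) := natr_powRN_cvg0 ge0.
  rewrite divr_gt0// => /(_ isT); apply: filterS => n.
  by rewrite sub0r normrN ger0_norm// powR_ge0.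
apply: filterS near_small => n; rewrite opprB => small.
pose N : R := n.+1%:R; rewrite -/N in small *.
have N1 : 1 <= N by rewrite ler1n.
have N0 : 0 < N by rewrite ltr0n.
pose E (x : R) : R := N `^ x.
have ED x y : E x * E y = E (x + y).
  by rewrite /E powRD//; apply/implyP => _; rewrite gt_eqF.
have EV x : (E x)^-1 = E (- x) by rewrite /E powRN.
have Epos x : 0 < E x by exact: powR_gt0.
have Ele x y : x <= y -> E x <= E y by move=> xy; exact: ler_powR.
have E1 : E 1 = N by rewrite /E powRr1// ltW.
have EX x y : E x `^ y = E (x * y) by rewrite /E powRrM.
have FhE : 2 * E (e - g) / 2 = E (e - g) by rewrite mulrAC divff// mul1r.
have small' : 4 * E (e - g) < f (A + D).
  by move: small; rewrite -/(E _) ltr_pdivlMr// mulrC.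
have FA : 2 * (2 * E (e - g)) <= f A.
  apply: le_trans (_ : f (A + D) <= _); last by apply: fni; rewrite lerDl ltW.
  by move: small'; clear; lra.
have deF : E (- g - 8 * e) <= 2 * E (e - g) / 2.
  by rewrite FhE; apply: Ele; clear -e0; lra.
have [B4 [mB4 pB4 B4P]] := close_pairs U_ind U_id g4 g2 x0A K0 QK fconv n.+1
  (Epos (- g - 8 * e)) deF FA.
(* The level is chosen so that [Q x = N ^ (e r - 1)]: the expected number of strengths above [x] is
   [N ^ (e r)], and by Chebyshev at least one of them occurs outside [B3]. *)
have [x [Ax fx Qx]] : exists x,
    [/\ A <= x, Q x `^ g = E (e - g) & Q x = E (e - g) `^ r].
  apply: (tail_powR_quantile g4 x0A K0 QK fconv) => //.
  by apply: le_trans FA; have := Epos (e - g); clear; lra.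
have pxE : fine (P (U 0%N @^-1` `]x, +oo[%classic)) = E (e * r - 1).
  have -> : E (e * r - 1) = Q x by rewrite Qx EX mulrBl gr.
  by congr (fine (P _)); apply/seteqP; split => w /=; rewrite in_itv/= andbT.
have [mB2 pB2] := chebyshev_RV U_ind U_id (measurable_itv `[a, b]) erefl p0 (ltn0Sn n).
have [mB3 pB3] := chebyshev_RV U_ind U_id (measurable_itv `]x, +oo[) pxE
  (Epos _) (ltn0Sn n).
have pB1 := markov_sum_sqr n.+1 (Epos (1 + e)) UK.
set B1 := [set w | E (1 + e) <= _] in pB1.
set B2 := [set w | _] in mB2 pB2; set B3 := [set w | _] in mB3 pB3.
have mB1 : measurable B1.
  apply: measurable_le_set; first exact: measurable_cst.
  by apply: measurable_sum => k; apply: measurable_funX; exact: measurable_funPT.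
have mB34 : measurable (B3 `|` B4) by exact: measurableU.
have mB234 : measurable (B2 `|` (B3 `|` B4)) by exact: measurableU.
have mB : measurable (B1 `|` (B2 `|` (B3 `|` B4))) by exact: measurableU.
have u1 := pr_setU_le P mB1 mB234; have u2 := pr_setU_le P mB2 mB34.
have u3 := pr_setU_le P mB3 mB4.
pose eta := N * expR (- (c * E (17 * e))).
have eta0 : 0 <= eta by rewrite /eta mulr_ge0 ?expR_ge0.
have := @annealed_ge _ _ _ P U n U_id U_gt0 (@last_wins_strictly n) _ _ mB eta0.
set an := annealed _ _ _; move=> lb.
have {}lb : 1 - eta - fine (P (B1 `|` (B2 `|` (B3 `|` B4)))) <= an.
  apply: lb => w nB pos; apply: rate => //.
  - have : ~ B2 w by move=> ?; apply: nB; right; left.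
    move/negP; rewrite -ltNge => /ltW /le_trans; apply.
    apply: ler_sum => k _; rewrite indicE.
    by case: (boolP (w \in _)) => //; rewrite inE /= in_itv/= => ->.
  - have : ~ B1 w by move=> ?; apply: nB; left.
    by move/negP; rewrite -ltNge => /ltW.
  - have : ~ B3 w by move=> ?; apply: nB; right; right; left.
    move/negP; rewrite -ltNge => s0.
    have {}s0 : 0 < \sum_(k < n.+1) \1_(U k @^-1` `]x, +oo[%classic) w :> R.
      by apply: le_lt_trans s0; rewrite divr_ge0// mulr_ge0// ltW.
    have [[k kn xU]|nk] := pselect (exists2 k, (k < n.+1)%N & x < U k w).
      by exists k => //; rewrite -/(E _) -fx; exact/fni/ltW.
    exfalso; move: s0; rewrite big1 ?ltxx// => k _; rewrite indicE memNset//=.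
    by rewrite in_itv/= andbT => xU; apply: nk; exists k.
  - by apply: le_lt_trans small'; have := Epos (e - g); rewrite /E; clear; lra.
  - by move=> k l kn ln kl; apply: B4P => // ?; apply: nB; right; right; right.
have b0' : eta <= Kd * E (- e).
  apply: le_trans (decay _ N1) _; rewrite -/(E _) ler_wpM2l ?(ltW Kd0)//.
  by apply: Ele; clear -g4 gE; lra.
have b1 : fine (P B1) <= K * E (- e).
  apply: le_trans pB1 _; rewrite -/N -E1 EV mulrAC ED mulrC.
  by have -> : 1 + - (1 + e) = - e by [clear; lra].
have b2 : fine (P B2) <= 4 / p * E (- e).
  apply: le_trans pB2 _; rewrite -/N -E1 invfM mulrCA mulrC EV.
  rewrite ler_wpM2l ?divr_ge0 ?(ltW p0)//.
  by apply: Ele; clear -g4 gE; lra.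
have b3 : fine (P B3) <= 4 * E (- e).
  apply: le_trans pB3 _; rewrite -/N ler_wpM2l// -E1 ED EV; apply: Ele.
  have : e * 1 <= e * r by rewrite ler_wpM2l ?(ltW e0)//; clear -r2; lra.
  by clear; lra.
have b4 : fine (P B4) <= H * E (- e).
  by apply: le_trans pB4 _; exact: pair_bound_rate.
move: b0' b1 b2 b3 b4 lb u1 u2 u3; rewrite !mulrDl -/(E _).
move: (H * E (- e)) (4 / p * E (- e)) (Kd * E (- e)) (K * E (- e)) (4 * E (- e)).
by move=> z1 z2 z3 z4 z5; clear; lra.
Qed.

Theorem theorem1 (d : measure_display) (T : measurableType d) (R : realType)
  (P : probability T R) (U : nat -> {RV P >-> R}) :
  mutually_independent P (fun k => U k) ->
  identically_distributed P (fun k => U k) ->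
  P [set w | U 0%N w <= 0] = 0%E ->
  (\int[P]_w ((U 0%N w) ^+ 2)%:E < +oo)%E ->
  (exists (beta x0 : R), 0 < beta < 2^-1 /\ 0 < x0 /\
     interior (law_support P (U 0%N)) x0 /\
     convex_on_from (fun x => powR (tail P (U 0%N) x) (2^-1 - beta)) x0) ->
  (forall n : nat, annealed P (fun k => U k) (@last_wins_strictly n)
                   <= annealed P (fun k => U k) (@last_wins n)) /\
  ((fun n : nat => annealed P (fun k => U k) (@last_wins_strictly n)) @ \oo --> (1 : R)).
Proof.
move=> U_ind U_id U_gt0 U_sqr [beta [x0 [/andP[be0 be2] [x00 [x0i conv]]]]]; split.
  move=> n; apply: annealed_le => // x; rewrite !unfold_in => /forallP sx.
  apply/forallP => i; have [->//|im] := eqVneq i ord_max.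
  by have := sx i; rewrite im /= => /ltnW.
have [K K0 UK] := second_moment_bound U_id U_sqr.
have [[A [D [x0A D0 QAD]]] [a [b [a0 b0 pab]]]] := law_support_interior x00 x0i.
(* Raising the tail to a larger power keeps convexity, so the exponent may be taken at least
   [1 / 4]; it stays below [1 / 2] because [beta > 0]. *)
pose g := Num.max 4^-1 (2^-1 - beta).
have g4 : 4^-1 <= g by rewrite /g le_max lexx.
have gb : 2^-1 - beta <= g by rewrite /g le_max lexx orbT.
have g2 : g < 2^-1 by rewrite /g gt_max; apply/andP; split; lra.
have s0 : 0 < 2^-1 - beta by lra.
have convg : convex_on_from (fun x => tail P (U 0%N) x `^ g) x0.
  have g1 : 1 <= g / (2^-1 - beta) by rewrite ler_pdivlMr// mul1r.
  have := convex_on_from_powR g1 (fun x => powR_ge0 _ _) conv.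
  have E x : (tail P (U 0%N) x `^ (2^-1 - beta)) `^ (g / (2^-1 - beta)) =
      tail P (U 0%N) x `^ g.
    by rewrite -powRrM mulrC divfK// gt_eqF.
  by move=> h y z t yx zx t01; have := h y z t yx zx t01; rewrite !E.
have [M [e [e0 lb]]] := annealed_strict_lb U_ind U_id U_gt0 UK K0 g4 g2 x00 x0A
  D0 QAD a0 b0 pab convg.
apply: (@squeeze_cvgr _ _ _ _ (fun n => 1 - M * n.+1%:R `^ (- e)) (fun=> 1)).
- near=> n; apply/andP; split; first by near: n.
  exact: annealed_le1.
- rewrite -[X in _ --> X]subr0; apply: cvgB; first exact: cvg_cst.
  by rewrite -[X in _ --> X](mulr0 M); apply: cvgMr; exact: natr_powRN_cvg0.
- exact: cvg_cst.
Unshelve. all: by end_near. Qed.
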